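(* Let $\mu$ be a nonzero finite Borel measure on $\mathbb{R}^d$ and let $\Xi\subseteq\Theta$ be a nonempty convex set. Then the variation closure of the canonically convex exponential family $\mathcal{E}_\Xi=\{Q_\vartheta:\vartheta\in\Xi\}$ is $$\operatorname{cl}_v(\mathcal{E}_\Xi)=\bigcup_{F}\,\{Q_{F,\theta}:\theta\in\operatorname{cl}(\pi_F(\Xi))\cap\Theta_F\},$$ where the union runs over all $\Xi$-accessible faces $F$ of $\operatorname{cc}(\mu)$.
   Context: Convex sets. $\operatorname{cl}$ denotes closure and $\operatorname{ri}$ relative interior. For nonempty $B\subseteq\mathbb{R}^d$, $\operatorname{lin}(B)$ is the linear subspace obtained by shifting the affine hull of $B$ to contain the origin; for a nonempty convex set $C$, $\pi_C$ is the orthogonal projection of $\mathbb{R}^d$ onto $\operatorname{lin}(C)$. A face of a nonempty convex set $C$ is a nonempty convex subset $F\subseteq C$ such that $tx+(1-t)y\in F$ with $x,y\in C$, $0<t<1$ implies $x,y\in F$; it is proper if $F\ne C$. A unit vector $\tau\in\operatorname{lin}(C)$ exposes a proper face $F$ in $C$ if for some $a\in C$ one has $\langle\tau,x-a\rangle\le0$ for all $x\in C$ and $F=C\cap\{x:\langle\tau,x-a\rangle=0\}$. An access sequence to a face $F$ of $C$ is a sequence $\tau_1,\dots,\tau_m$ of unit vectors for which there is a chain $C=F_0\supset F_1\supset\cdots\supset F_m=F$ with $\tau_i\in\operatorname{lin}(F_{i-1})$ exposing the proper face $F_i$ in $F_{i-1}$ for $1\le i\le m$; the access sequence to $F=C$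 is empty ($m=0$). The recession cone of a convex set $\Xi$ is $\operatorname{rec}(\Xi)=\{\tau:\vartheta+t\tau\in\Xi\text{ for all }\vartheta\in\Xi,\ t\ge0\}$. For a nonempty convex $\Xi\subseteq\mathbb{R}^d$, an access sequence is adapted to $\Xi$ if $\tau_i\in\operatorname{rec}(\pi_{F_{i-1}}(\operatorname{ri}(\Xi)))$ for $1\le i\le m$; a face $F$ of $C$ is $\Xi$-accessible if there is an access sequence to $F$ adapted to $\Xi$ (so $C$ itself is always $\Xi$-accessible). Exponential families. The convex support $\operatorname{cs}(\mu)$, resp. convex core $\operatorname{cc}(\mu)$, is the intersection of all closed convex sets, resp. all convex Borel sets, $C\subseteq\mathbb{R}^d$ with $\mu(C)=\mu(\mathbb{R}^d)$; $\operatorname{lin}(\mu)=\operatorname{lin}(\operatorname{cs}(\mu))$. $\Lambda(\vartheta)=\ln\int_{\mathbb{R}^d}e^{\langle\vartheta,x\rangle}\mu(dx)$, $\operatorname{dom}(\Lambda)=\{\Lambda<\infty\}$, $\Theta=\operatorname{dom}(\Lambda)\cap\operatorname{lin}(\mu)$, and $Q_\vartheta$ ($\vartheta\in\operatorname{dom}(\Lambda)$) is the probability measure with $\mu$-density $e^{\langle\vartheta,x\rangle-\Lambda(\vartheta)}$. For a face $F$ of $\operatorname{cc}(\mu)$ (for which $\mu(\operatorname{cl}(F))>0$), $\Lambda_F(\vartheta)=\ln\int_{\operatorname{cl}(F)}e^{\langle\vartheta,x\rangle}\mu(dx)$, $\operatorname{dom}(\Lambda_F)=\{\Lambda_F<\infty\}$,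 $\Theta_F=\operatorname{dom}(\Lambda_F)\cap\operatorname{lin}(F)$, and for $\theta\in\operatorname{dom}(\Lambda_F)$, $Q_{F,\theta}$ is the probability measure with density $e^{\langle\theta,x\rangle-\Lambda_F(\theta)}$ with respect to the restriction of $\mu$ to $\operatorname{cl}(F)$. The variation closure $\operatorname{cl}_v(\mathcal{S})$ of a set $\mathcal{S}$ of Borel probability measures on $\mathbb{R}^d$ is the set of all probability measures $P$ for which there is a sequence $Q_n$ in $\mathcal{S}$ with total variation $|P-Q_n|\to0$. *)

(* Defs.v *)
From HB Require Import structures.
From mathcomp Require Import all_boot all_order all_algebra.
From mathcomp Require Import all_classical all_reals all_analysis.

Set Implicit Arguments.
Unset Strict Implicit.
Unset Printing Implicit Defensive.

Import Order.TTheory GRing.Theory Num.Theory.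
Import numFieldNormedType.Exports.

Local Open Scope classical_set_scope.
Local Open Scope ring_scope.

(* R^d is 'rV[R]_d with its Borel sigma-algebra, generated by the open sets.  *)
(* Its library norm is the sup norm, used below only through the topology it  *)
(* induces; Euclidean geometry goes through dot and l2norm.                   *)
HB.instance Definition _ (R : realType) (d : nat) :=
  @isMeasurable.Build (sigma_display (@open 'rV[R]_d)) 'rV[R]_d
    <<s @open 'rV[R]_d >>
    (@sigma_algebra0 _ setT (@open 'rV[R]_d))
    (@sigma_algebraC _ (@open 'rV[R]_d))
    (@sigma_algebra_bigcup _ setT (@open 'rV[R]_d)).

Section convex_sets.
Context {R : realType} {d : nat}.
Local Notation E := 'rV[R]_d.
Implicit Types (A B C F L Xi : set E) (u v x y a tau theta : E).

Definition dot u v : R := \sum_(i < d) u ord0 i * v ord0 i.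

Definition l2norm u : R := Num.sqrt (dot u u).

Definition affine_hull B : set E :=
  [set x | exists (n : nat) (c : 'I_n -> R) (b : 'I_n -> E),
    [/\ forall i, B (b i), \sum_(i < n) c i = 1 &
        x = \sum_(i < n) c i *: b i]].

(* The shift of the affine hull of B by - a does not depend on a in B. *)
Definition lin B : set E := [set x - a | x in affine_hull B & a in B].

(* Orthogonal projection onto a linear subspace L. *)
Definition orth_proj L x : E :=
  get [set y | L y /\ forall z, L z -> dot (x - y) z = 0].

Definition pi_ C : E -> E := orth_proj (lin C).

Definition ri A : set E :=
  [set x | A x /\ within (affine_hull A) (nbhs x) A].

Definition is_face C F : Prop :=
  [/\ F !=set0, convex_set F, F `<=` C &
      forall x y (t : R), C x -> C y -> 0 < t < 1 ->
        F (t *: x + (1 - t) *: y) -> F x /\ F y].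

Definition exposes C tau F : Prop :=
  [/\ l2norm tau = 1, lin C tau, is_face C F /\ F <> C &
      exists a, [/\ C a, forall x, C x -> dot tau (x - a) <= 0 &
                    F = C `&` [set x | dot tau (x - a) = 0]]].

(* tau is indexed from 0: tau`_i exposes F_ i.+1 in F_ i. *)
Definition access_chain C F (tau : seq E) (F_ : nat -> set E) : Prop :=
  [/\ F_ 0%N = C, F_ (size tau) = F &
      forall i, (i < size tau)%N -> exposes (F_ i) tau`_i (F_ i.+1)].

Definition recession_cone Xi : set E :=
  [set tau | forall theta (t : R), Xi theta -> 0 <= t -> Xi (theta + t *: tau)].

(* The chain F_ is determined by C and tau on the relevant indices. *)
Definition adapted_access_sequence Xi C F (tau : seq E) : Prop :=
  exists2 F_ : nat -> set E, access_chain C F tau F_ &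
    forall i, (i < size tau)%N ->
      recession_cone (pi_ (F_ i) @` ri Xi) tau`_i.

Definition accessible_face Xi C F : Prop :=
  is_face C F /\ exists tau : seq E, adapted_access_sequence Xi C F tau.

End convex_sets.

Section total_variation.
Context {disp : measure_display} {T : measurableType disp} {R : realType}.

Definition total_variation (nu : {charge set T -> \bar R}) : \bar R :=
  let P := cid (Hahn_decomposition nu) in
  let N := cid (svalP P) in
  charge_variation (svalP N) setT.

Definition variation_distance (P Q : probability T R) : \bar R :=
  total_variation (cadd (charge_of_finite_measure P)
                        (copp (charge_of_finite_measure Q))).

Definition cl_v (S : set (probability T R)) : set (probability T R) :=
  [set P | exists2 Q : nat -> probability T R, forall n, S (Q n) &
    (fun n => variation_distance P (Q n)) @ \oo --> 0%E].

End total_variation.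

Section exponential_families.
Context {R : realType} {d : nat}.
Local Notation E := 'rV[R]_d.
Variable mu : {finite_measure set E -> \bar R}.
Implicit Types (B C F Xi : set E) (theta : E).

Definition cs : set E :=
  \bigcap_(C in [set C : set E | [/\ closed C, convex_set C & mu C = mu setT]]) C.

Definition cc : set E :=
  \bigcap_(C in [set C : set E | [/\ measurable C, convex_set C & mu C = mu setT]]) C.

(* Log-Laplace transform of the restriction of mu to B; the functions written *)
(* Lambda and Lambda_F are the cases B = R^d and B = cl(F).                   *)
Definition log_laplace B theta : \bar R :=
  lne (\int[mu]_(x in B) (expR (dot theta x))%:E).

Definition dom_log_laplace B : set E :=
  [set theta | (log_laplace B theta < +oo)%E].

Definition Theta : set E := dom_log_laplace setT `&` lin cs.

Definition Theta_face F : set E := dom_log_laplace (closure F) `&` lin F.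

(* Probability measures with density exp(<theta, x> - log_laplace B theta)    *)
(* with respect to the restriction of mu to B.  A library measure also        *)
(* assigns values to non-measurable sets, so a law is represented by all      *)
(* P : probability that agree with it on Borel sets.                          *)
Definition exp_law B theta : set (probability E R) :=
  [set P | forall A, measurable A ->
    P A = (\int[mu]_(x in A `&` B)
             expeR ((dot theta x)%:E - log_laplace B theta))%E].

Definition exp_family Xi : set (probability E R) :=
  \bigcup_(theta in Xi) exp_law setT theta.

Definition exp_family_face F Xi : set (probability E R) :=
  \bigcup_(theta in closure (pi_ F @` Xi) `&` Theta_face F)
    exp_law (closure F) theta.

End exponential_families.

(* Main.v *)
(* If tau exposes G in F, the laws on cl F with parameters theta + n tau
   converge in variation to the law on cl G with parameter theta, because the
   mass concentrates where <tau, .> is maximal.  Following an adapted access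
   sequence, every law on an accessible face with parameter in the relative
   interior of Xi is therefore a limit; laws with parameter in the closure of
   the projection of Xi are reached along segments, on which the exponentials
   are dominated by the sum of those at the endpoints.

   Conversely, if laws with parameters theta_n in Xi converge to P, then along a
   subsequence their densities converge almost everywhere.  Refine it by an
   ultrafilter and project theta_n to lin F, starting with F = cc mu.  If the
   projections are bounded they converge, and P is the law on cl F with the
   limit parameter.  Otherwise their directions converge to some tau in the
   recession cone; comparing densities at two points shows that tau exposes a
   face G of F with P (cl G) = 1, and one continues with G, whose dimension is
   smaller.

   Both directions need that cl F and the mass it carries determine F: every
   face F reached this way is the convex core of the restriction of mu to cl F. *)
Require Import Defs.
From HB Require Import structures.
From mathcomp Require Import all_boot all_order all_algebra.
From mathcomp Require Import all_classical all_reals all_analysis.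
From mathcomp Require Import measurable_realfun ring lra.

Set Implicit Arguments.
Unset Strict Implicit.
Unset Printing Implicit Defensive.

Import Order.TTheory GRing.Theory Num.Theory.
Import numFieldNormedType.Exports.

Local Open Scope classical_set_scope.
Local Open Scope ring_scope.

(** * Linear hulls and orthogonal projections *)

Section euclidean.
Context {R : realType} {d : nat}.
Local Notation E := 'rV[R]_d.
Implicit Types (B : set E) (u v w x y z : E).

Lemma dotE u v : dot u v = (u *m v^T) 0 0.
Proof. by rewrite /dot mxE; apply: eq_bigr => i _; rewrite mxE. Qed.

Lemma dotC u v : dot u v = dot v u.
Proof. by apply: eq_bigr => i _; rewrite mulrC. Qed.

Lemma dotDl u v w : dot (u + v) w = dot u w + dot v w.
Proof. by rewrite !dotE mulmxDl mxE. Qed.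

Lemma dotZl (k : R) u v : dot (k *: u) v = k * dot u v.
Proof. by rewrite !dotE -scalemxAl mxE. Qed.

Lemma dotNl u v : dot (- u) v = - dot u v.
Proof. by rewrite -scaleN1r dotZl mulN1r. Qed.

Lemma dotBl u v w : dot (u - v) w = dot u w - dot v w.
Proof. by rewrite dotDl dotNl. Qed.

Lemma dotDr u v w : dot u (v + w) = dot u v + dot u w.
Proof. by rewrite !(dotC u) dotDl. Qed.

Lemma dotZr (k : R) u v : dot u (k *: v) = k * dot u v.
Proof. by rewrite !(dotC u) dotZl. Qed.

Lemma dotBr u v w : dot u (v - w) = dot u v - dot u w.
Proof. by rewrite !(dotC u) dotBl. Qed.

Lemma dot_ge0 u : 0 <= dot u u.
Proof. by apply: sumr_ge0 => i _; rewrite -expr2 sqr_ge0. Qed.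

Lemma dot_eq0 u : dot u u = 0 -> u = 0.
Proof.
move=> u0; apply/rowP => i; rewrite mxE; apply/eqP; rewrite -sqrf_eq0 expr2.
have /eqP := u0; rewrite psumr_eq0; last by move=> j _; rewrite -expr2 sqr_ge0.
by move/allP => /(_ i); rewrite mem_index_enum => /(_ isT).
Qed.

Lemma norm_le_l2norm u : `|u| <= l2norm u.
Proof.
rewrite [leLHS]/Num.norm/= mx_normrE; apply/bigmax_leP; split; first exact: sqrtr_ge0.
move=> [i j] _ /=; rewrite (ord1 i) -sqrtr_sqr ler_wsqrtr// /dot (bigD1 j)//=.
rewrite expr2 lerDl; apply: sumr_ge0 => k _; by rewrite -expr2 sqr_ge0.
Qed.

Lemma continuous_mulmx m n (M : 'M[R]_(m, n)) :
  continuous (fun x : 'rV[R]_m => x *m M).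
Proof.
rewrite (_ : (fun a => _) = fun x : 'rV[R]_m => \sum_i x ord0 i *: row i M); last first.
  by apply/funext => x; rewrite mulmx_sum_row.
apply: continuous_big => [[x y]|i _].
  exact: add_continuous.
move=> /= a; apply: (@cvgZr_tmp _ _ _ (nbhs (a : 'rV[R]_m))).
exact: (@coord_continuous R).
Qed.

Lemma continuous_dot u : continuous (dot u : E -> R).
Proof.
rewrite (_ : dot u = (fun x => (x *m u^T) 0 0)); last first.
  by apply/funext => x; rewrite dotC dotE.
move=> x; apply: (@cvg_comp _ _ _ (fun x => x *m u^T) (fun M : 'rV[R]_1 => M 0 0)).
  exact: continuous_mulmx.
exact: coord_continuous.
Qed.

(** If no free family drawn from [B] spanned [B], every such family could be enlarged by one vector,
    giving d + 1 independent vectors in dimension d. *)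
Lemma row_basis B : exists r (V : 'M[R]_(r, d)),
  [/\ row_free V, forall i, B (row i V) & forall b, B b -> (b <= V)%MS].
Proof.
apply: contrapT => noV.
have ext n : exists r (V : 'M[R]_(r, d)),
    [/\ r = n, row_free V & forall i, B (row i V)].
  elim: n => [|n [r [V [rn fV BV]]]].
    exists 0%N, 0; split => //; last by case.
    by rewrite /row_free mxrank0.
  have [b Bb bV] : exists2 b, B b & ~~ (b <= V)%MS.
    apply: contrapT => nob; apply: noV; exists r, V; split => // b Bb.
    by apply: contrapT => /negP bV; apply: nob; exists b.
  exists (r + 1)%N, (col_mx V b); split; first by rewrite rn addn1.
    have /rank_ltmx : (V < col_mx V b)%MS.
      by rewrite ltmxE -(addsmxE V b) addsmxSl col_mx_sub submx_refl.
    move: fV; rewrite /row_free => /eqP -> rV.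
    by rewrite eqn_leq rank_leq_row [X in (X <= _)%N]addn1.
  move=> i; case: (split_ordP i) => j ->.
    by rewrite rowKu.
  by rewrite rowKd (_ : row j b = b)//; apply/rowP => k; rewrite mxE ord1.
have [r [V [rd]]] := ext d.+1.
by rewrite /row_free => /eqP rV _; have := rank_leq_col V; rewrite rV rd ltnn.
Qed.

Lemma lin_sub B x y : B x -> B y -> lin B (x - y).
Proof.
move=> Bx By; exists x; last by exists y.
exists 1%N, (fun=> 1), (fun=> x); split => //; first by rewrite big_ord1.
by rewrite big_ord1 scale1r.
Qed.

Lemma affine_hull_submx B b r (V : 'M[R]_(r, d)) : B b ->
  (forall i, [set x - b | x in B] (row i V)) ->
  (forall x, B x -> (x - b <= V)%MS) ->
  affine_hull B = [set x | (x - b <= V)%MS].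
Proof.
move=> Bb rV Vb; apply/seteqP; split => u /=.
  move=> [n [c [x [Bx c1 ->]]]].
  rewrite (_ : _ - b = \sum_(i < n) c i *: (x i - b)).
    by rewrite summx_sub// => i _; rewrite scalemx_sub ?Vb.
  under [RHS]eq_bigr do rewrite scalerBr.
  by rewrite sumrB -scaler_suml c1 scale1r.
move=> /submxP[w /(canRL (subrK _)) ->].
have /choice[x Bx] : forall i, exists y, B y /\ y - b = row i V.
  by move=> i; have [y ? ?] := rV i; exists y.
(* One extra index, [ord_max], carries the base point [b]; its weight makes the coefficients sum to
   1. *)
pose f := fun i : 'I_r.+1 => oapp x b (unlift ord_max i).
pose c := fun i : 'I_r.+1 => oapp (w 0) (1 - \sum_i w 0 i) (unlift ord_max i).
have widenE (i : 'I_r) : widen_ord (leqnSn r) i = lift ord_max i.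
  by apply/val_inj; rewrite /= /bump leqNgt ltn_ord.
exists r.+1, c, f; split.
- by move=> i; rewrite /f; case: unliftP => [j _|_] //=; case: (Bx j).
- rewrite big_ord_recr/= {2}/c unlift_none/= (eq_bigr (w 0)).
    by rewrite addrC subrK.
  by move=> i _; rewrite widenE /c liftK.
- rewrite big_ord_recr/= {2}/c {2}/f unlift_none/=.
  rewrite (eq_bigr (fun i => w 0 i *: x i)); last first.
    by move=> i _; rewrite widenE /c /f liftK.
  rewrite mulmx_sum_row scalerBl scale1r addrCA scaler_suml -sumrB addrC.
  congr (_ + _); apply: eq_bigr => i _.
  by have [_ <-] := Bx i; rewrite scalerBr.
Qed.

Lemma lin_submx B b r (V : 'M[R]_(r, d)) : B b ->
  (forall i, [set x - b | x in B] (row i V)) ->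
  (forall x, B x -> (x - b <= V)%MS) -> lin B = [set u | (u <= V)%MS].
Proof.
move=> Bb rV Vb; rewrite /lin (affine_hull_submx Bb rV Vb).
apply/seteqP; split => u /=.
  move=> [x xV [a Ba <-]].
  rewrite (_ : x - a = (x - b) - (a - b)); last by rewrite opprB addrA subrK.
  by rewrite addmx_sub// eqmx_opp Vb.
by move=> uV; exists (u + b); [rewrite addrK|exists b => //; rewrite addrK].
Qed.

(** Turns statements about the subspace into row-space algebra: closure under the operations,
    closedness, projection and dimension all go through it. *)
Lemma lin_rowspace B : B !=set0 -> exists r (V : 'M[R]_(r, d)),
  row_free V /\ lin B = [set u | (u <= V)%MS].
Proof.
move=> [b Bb]; have [r [V [fV rV Vb]]] := row_basis [set x - b | x in B].
exists r, V; split => //; apply: lin_submx Bb rV _ => x Bx.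
by apply: Vb; exists x.
Qed.

Lemma lin0 B : B !=set0 -> lin B 0.
Proof. by move=> /lin_rowspace[r [V [_ ->]]]; exact: sub0mx. Qed.

Lemma linD B u v : B !=set0 -> lin B u -> lin B v -> lin B (u + v).
Proof. by move=> /lin_rowspace[r [V [_ ->]]] /=; exact: addmx_sub. Qed.

Lemma linZ B (k : R) u : B !=set0 -> lin B u -> lin B (k *: u).
Proof. by move=> /lin_rowspace[r [V [_ ->]]] /=; exact: scalemx_sub. Qed.

Lemma linB B u v : B !=set0 -> lin B u -> lin B v -> lin B (u - v).
Proof. by move=> B0 Lu Lv; rewrite -scaleN1r; apply/linD/linZ. Qed.

Lemma closed_lin B : B !=set0 -> closed (lin B).
Proof.
move=> /lin_rowspace[r [V [_ ->]]].
(* A row space is the kernel of a continuous linear map. *)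
rewrite (_ : mkset _ = (fun u => u *m cokermx V) @^-1` [set 0]).
  apply: closed_comp; first by move=> u _; exact: continuous_mulmx.
  exact/accessible_closed_set1/hausdorff_accessible/norm_hausdorff.
by apply/seteqP; split => u /=; rewrite submxE => /eqP.
Qed.

Lemma affine_hullE B b : B b -> affine_hull B = [set x | lin B (x - b)].
Proof.
move=> Bb; have [r [V [fV rV Vb]]] := row_basis [set x - b | x in B].
have {}Vb x : B x -> (x - b <= V)%MS by move=> Bx; apply: Vb; exists x.
by rewrite (lin_submx Bb rV Vb) (affine_hull_submx Bb rV Vb).
Qed.

Lemma orth_proj_mx r (V : 'M[R]_(r, d)) : row_free V -> exists P : 'M[R]_d,
  forall x, (x *m P <= V)%MS /\
    forall z, (z <= V)%MS -> dot (x - x *m P) z = 0.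
Proof.
(* The Gram matrix is invertible: a row [w] that it kills gives [w *m V] squared length zero, and
   the rows of [V] are free. *)
move=> fV; have VVu : V *m V^T \in unitmx.
  rewrite -row_free_unit; apply: inj_row_free => w wVV.
  suff /(row_free_injr fV) : w *m V = 0 *m V by [].
  rewrite mul0mx; apply: dot_eq0.
  by rewrite dotE trmx_mul mulmxA -(mulmxA w) wVV mul0mx mxE.
exists (V^T *m invmx (V *m V^T) *m V) => x; split.
  by rewrite !mulmxA submxMl.
move=> z /submxP[w ->]; rewrite dotE trmx_mul mulmxBl.
rewrite [X in _ - X](_ : _ = x *m (V^T *m w^T)) ?subrr ?mxE//.
by rewrite -!mulmxA (mulmxA V) mulKmx.
Qed.

Lemma pi_mx B : B !=set0 -> exists P : 'M[R]_d, forall x, pi_ B x = x *m P.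
Proof.
move=> B0; have [r [V [fV linE]]] := lin_rowspace B0.
have [P xP] := orth_proj_mx fV; exists P => x; rewrite /pi_ /orth_proj linE.
have [xPV xPo] := xP x; set S := (X in get X).
have /getPex[gV go] : exists y, S y by exists (x *m P).
(* Two candidates for the projection differ by a vector that lies in the subspace and is orthogonal
   to it. *)
apply/eqP; rewrite -subr_eq0; apply/eqP/dot_eq0.
have xV : (get S - x *m P <= V)%MS by rewrite addmx_sub// eqmx_opp.
rewrite {1}(_ : get S - x *m P = (x - x *m P) - (x - get S)).
  by rewrite dotBl xPo// go// subrr.
by rewrite opprB [RHS]addrC addrA subrK.
Qed.

Lemma pi_lin B x : B !=set0 -> lin B (pi_ B x).
Proof.
move=> B0; have [r [V [fV linE]]] := lin_rowspace B0.
have [P xP] := orth_proj_mx fV; rewrite /pi_ /orth_proj linE.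
set S := (X in get X); have [xPV xPo] := xP x.
by have /getPex[] : exists y, S y by exists (x *m P).
Qed.

Lemma pi_orth B x z : B !=set0 -> lin B z -> dot (x - pi_ B x) z = 0.
Proof.
move=> B0; have [r [V [fV linE]]] := lin_rowspace B0.
have [P xP] := orth_proj_mx fV; rewrite /pi_ /orth_proj linE.
set S := (X in get X); have [xPV xPo] := xP x.
have /getPex[_ So] : exists y, S y by exists (x *m P).
exact: So.
Qed.

Lemma dot_pi B x z : B !=set0 -> lin B z -> dot (pi_ B x) z = dot x z.
Proof. by move=> B0 Lz; apply/eqP; rewrite eq_sym -subr_eq0 -dotBl pi_orth. Qed.

Lemma piD B x y : B !=set0 -> pi_ B (x + y) = pi_ B x + pi_ B y.
Proof. by move=> /pi_mx[P piE]; rewrite !piE mulmxDl. Qed.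

Lemma pi_id B x : B !=set0 -> lin B x -> pi_ B x = x.
Proof.
move=> B0 Lx; apply/esym/eqP; rewrite -subr_eq0; apply/eqP/dot_eq0.
by rewrite pi_orth//; apply: linB => //; exact: pi_lin.
Qed.

Lemma l2normZ (k : R) u : l2norm (k *: u) = `|k| * l2norm u.
Proof.
by rewrite /l2norm dotZl dotZr mulrA -expr2 sqrtrM ?sqr_ge0// sqrtr_sqr.
Qed.

(** A nonzero [tau] orthogonal to [lin B'] cannot belong to it. Passing to an exposed face therefore
    lowers the dimension, which makes the descent through faces terminate. *)
Lemma lin_rank_lt B B' tau r (V : 'M[R]_(r, d)) r' (V' : 'M[R]_(r', d)) :
  lin B = [set u | (u <= V)%MS] -> lin B' = [set u | (u <= V')%MS] ->
  lin B' `<=` lin B -> lin B tau -> tau != 0 ->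
  (forall u, lin B' u -> dot tau u = 0) -> (\rank V' < \rank V)%N.
Proof.
move=> LV LV' LL Ltau tau0 tauo; apply: rank_ltmx; rewrite ltmxE; apply/andP; split.
  apply/row_subP => i; suff: lin B (row i V') by rewrite LV.
  by apply: LL; rewrite LV' /=; exact: row_sub.
apply: contra tau0 => VV'; apply/eqP/dot_eq0/tauo.
by move: Ltau; rewrite LV LV' /= => /submx_trans; apply.
Qed.

Lemma lin_subset B B' : B' `<=` B -> lin B' `<=` lin B.
Proof.
move=> BB _ [x [n [c [f [Bf c1 ->]]]] [a Ba <-]]; exists (\sum_(i < n) c i *: f i).
  by exists n, c, f; split => // i; exact/BB/Bf.
by exists a => //; exact: BB.
Qed.

(** Affine coefficients sum to 1, so a linear form constant on [B] keeps that value on the affine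
    hull. *)
Lemma lin_dot0 B u b : B b -> (forall x, B x -> dot u (x - b) = 0) ->
  forall z, lin B z -> dot u z = 0.
Proof.
move=> Bb ub _ [_ [n [c [f [Bf c1 ->]]]] [a Ba <-]].
have ua : dot u a = dot u b by apply/eqP; rewrite -subr_eq0 -dotBr ub.
rewrite dotBr ua dotC dotE mulmx_suml summxE.
under eq_bigr do rewrite -scalemxAl mxE -dotE.
rewrite (eq_bigr (fun i => c i * dot u b)).
  by rewrite -mulr_suml c1 mul1r subrr.
by move=> i _; congr (_ * _); apply/eqP; rewrite dotC -subr_eq0 -dotBr ub.
Qed.

(** The affine hull is closed, so it already contains the closure. *)
Lemma lin_closure B x a : B a -> closure B x -> lin B (x - a).
Proof.
move=> Ba Bx; have B0 : B !=set0 by exists a.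
have : closed (affine_hull B).
  rewrite (affine_hullE Ba); rewrite -[X in closed X]/((fun x : E => x - a) @^-1` lin B).
  apply: closed_comp; first move=> y _.
    by apply: (@continuousB _ E E id (cst a)) => //; exact: cst_continuous.
  exact: (closed_lin B0).
move=> /closure_id aE; suff: affine_hull B x by rewrite (affine_hullE Ba).
rewrite aE; apply: closure_subset Bx => y By.
by exists 1%N, (fun=> 1), (fun=> y); split => //; rewrite big_ord1 ?scale1r.
Qed.

End euclidean.

(** * Relative interiors *)

Section relative_interior.
Context {R : realType} {d : nat}.
Local Notation E := 'rV[R]_d.
Implicit Types (A B C F : set E) (u v w x y z : E) (t : R).

Lemma convex_setP A : convex_set A <->
  forall x y t, A x -> A y -> 0 <= t <= 1 -> A (t *: x + (1 - t) *: y).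
Proof.
split=> [cA x y t Ax Ay /andP[t0 t1]|cA x y t].
  by have := cA x y (Itv01 t0 t1); rewrite !inE; apply.
by rewrite !inE => Ax Ay; apply: cA => //; rewrite ge0/= le1.
Qed.

Lemma convex_setI A B : convex_set A -> convex_set B -> convex_set (A `&` B).
Proof.
move=> /convex_setP cA /convex_setP cB; apply/convex_setP => x y t [Ax Bx] [Ay By] t01.
by split; [exact: cA|exact: cB].
Qed.

Lemma convex_bigcap (I : Type) (D : set I) (G : I -> set E) :
  (forall i, D i -> convex_set (G i)) -> convex_set (\bigcap_(i in D) G i).
Proof.
move=> cG; apply/convex_setP => x y t Gx Gy t01 i Di.
by move/convex_setP : (cG _ Di); apply => //; [exact: Gx|exact: Gy].
Qed.

(** The base point [b] absorbs the weight that the [c i] leave over; the induction splits off the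
    last vertex. *)
Lemma convex_simplex A b n (c : 'I_n -> R) (v : 'I_n -> E) :
  convex_set A -> A b -> (forall i, A (b + v i)) -> (forall i, 0 <= c i) ->
  \sum_(i < n) c i <= 1 -> A (b + \sum_(i < n) c i *: v i).
Proof.
move=> /convex_setP cA Ab; elim: n c v => [|n IH] c v Av c0 c1.
  by rewrite big_ord0 addr0.
rewrite big_ord_recr/=; set s := c ord_max.
move: c1; rewrite big_ord_recr/= -/s => c1.
pose c' i := c (widen_ord (leqnSn n) i); have c'0 i : 0 <= c' i by exact: c0.
have {}c1 : \sum_(i < n) c' i <= 1 - s by rewrite lerBrDr.
have s1 : 0 <= 1 - s by rewrite (le_trans _ c1)// sumr_ge0.
have c'le i : c' i <= 1 - s.
  by rewrite (le_trans _ c1)// (bigD1 i)//= lerDl sumr_ge0.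
(* If s = 1 the division yields 0, and the remaining weights are 0 as well. *)
have c'E i : (1 - s) * (c' i / (1 - s)) = c' i.
  have [s0|s0] := eqVneq (1 - s) 0; last by rewrite mulrC divfK.
  by rewrite s0 mul0r; apply/eqP; rewrite eq_le c'0 -s0 c'le.
rewrite (_ : b + _ = s *: (b + v ord_max) + (1 - s) *:
    (b + \sum_(i < n) (c' i / (1 - s)) *: v (widen_ord (leqnSn n) i))).
  apply: cA.
  - exact: Av.
  - apply: IH => // [i|]; first by rewrite divr_ge0.
    rewrite -mulr_suml; have [s0|s0] := eqVneq (1 - s) 0.
      by rewrite s0 invr0 mulr0.
    by rewrite ler_pdivrMr ?mul1r// lt_neqAle eq_sym s0.
  - by rewrite c0/= -subr_ge0.
rewrite !scalerDr addrACA -scalerDl [s + _]addrC subrK scale1r scaler_sumr.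
rewrite [s *: _ + _]addrC; congr (b + (_ + _)).
by apply: eq_bigr => i _; rewrite scalerA c'E.
Qed.

Lemma riP A x : A x -> ri A x <->
  exists2 e : R, 0 < e & forall u, lin A u -> `|u| < e -> A (x + u).
Proof.
move=> Ax; split=> [[_ xA]|[e e0 Ae]].
  have /nbhs_normP[e /= e0 Ae] : nbhs x [set y | affine_hull A y -> A y] by [].
  exists e => // u Lu ue.
  apply: Ae; first by rewrite /ball_/= opprD addNKr normrN.
  by rewrite (affine_hullE Ax)/= addrAC subrr add0r.
split=> //; suff : nbhs x [set y | affine_hull A y -> A y] by [].
apply/(@nbhs_normP R E); exists e => //= y.
rewrite /ball_/= (affine_hullE Ax)/= distrC => xy Ly.
by rewrite -[y](subrK x) addrC; exact: Ae.
Qed.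

Lemma ri_sub A : ri A `<=` A.
Proof. by move=> x []. Qed.

(** [A] contains a simplex on [b] and a basis of [lin A]; a point of it with positive coordinates of
    sum less than 1 tolerates small changes of all coordinates. *)
Lemma ri_nonempty A : convex_set A -> A !=set0 -> ri A !=set0.
Proof.
move=> cA [b Ab]; have [r [V [fV rV Vb]]] := row_basis [set x - b | x in A].
have {}Vb x : A x -> (x - b <= V)%MS by move=> Ax; apply: Vb; exists x.
have linE := lin_submx Ab rV Vb.
(* With each coordinate between 0 and 2s, the r coordinates sum to at most r / (r + 1). *)
pose s : R := (2 * r.+1)%:R^-1.
have s0 : 0 < s by rewrite invr_gt0 ltr0n muln_gt0.
have Ac (c : 'rV[R]_r) : (forall i, `|c 0 i| <= s) ->
    A (b + \sum_i (s + c 0 i) *: row i V).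
  move=> cs; apply: convex_simplex => //.
  - by move=> i; have [x Ax <-] := rV i; rewrite addrC subrK.
  - by move=> i; have := cs i; rewrite ler_norml => /andP[+ _]; rewrite -subr_ge0 opprK addrC.
  - apply: (@le_trans _ _ (\sum_(i < r) (s *+ 2))).
      apply: ler_sum => i _; rewrite mulr2n lerD2l.
      by have := cs i; rewrite ler_norml => /andP[].
    rewrite sumr_const card_ord -mulrnA -mulr_natl ler_pdivrMr ?ltr0n ?muln_gt0//.
    by rewrite mul1r ler_nat leq_mul2l leqnSn.
have A0 : A (b + \sum_i s *: row i V).
  have := Ac 0; under eq_bigr do rewrite mxE addr0; apply => i.
  by rewrite mxE normr0 ltW.
exists (b + \sum_i s *: row i V); apply/(riP A0).
(* The coordinates of [u] in the basis depend continuously on [u], so a short [u] changes each by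
   less than [s]. *)
have /(_ 0)/cvgr_dist_lt : continuous (fun u : E => u *m pinvmx V) by exact: continuous_mulmx.
move=> /(_ _ s0)/nbhs_normP[e /= e0 es]; exists e => // u.
rewrite linE/= => uV ue; have {es}us : `|u *m pinvmx V| < s.
  by have := es u; rewrite /ball_/= sub0r normrN mul0mx sub0r normrN; apply.
rewrite -addrA -(mulmxKpV uV) [u *m _ *m _]mulmx_sum_row -big_split/=.
under eq_bigr do rewrite -scalerDl.
apply: Ac => i; apply: le_trans (ltW us).
rewrite [leRHS]/Num.norm/= mx_normrE; apply/bigmax_geP; right => /=.
by exists (0, i).
Qed.

(** Replace [y] by a nearby [y'] in [A]; the error, together with the perturbation [u], is absorbed
    by the room that [A] has around [x], scaled by [t]. *)
Lemma ri_segment A x y t : convex_set A -> ri A x -> closure A y -> 0 < t <= 1 ->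
  ri A (t *: x + (1 - t) *: y).
Proof.
move=> /convex_setP cA xA yA /andP[t0 t1]; have Ax := ri_sub xA.
have A0 : A !=set0 by exists x.
move/(riP Ax) : xA => [e e0 Ae].
have te0 : 0 < t * e / 2 by rewrite divr_gt0// mulr_gt0.
have H u : lin A u -> `|u| < t * e / 2 -> A (t *: x + (1 - t) *: y + u).
  move=> Lu ue; have [y' [Ay' /= yy']] := yA _ (nbhsx_ballx y _ te0).
  move: yy'; rewrite -ball_normE /ball_/= => yy'.
  have -> : t *: x + (1 - t) *: y + u =
      t *: (x + t^-1 *: (u + (1 - t) *: (y - y'))) + (1 - t) *: y'.
    rewrite scalerDr scalerA mulfV ?lt0r_neq0// scale1r scalerBr.
    by rewrite -!addrA addNr addr0 [u + _]addrC.
  apply: cA => //; last by rewrite t1 ltW.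
  apply: Ae; first by apply/linZ/linD/linZ/lin_closure.
  rewrite normrZ gtr0_norm ?invr_gt0// mulrC ltr_pdivrMr//.
  rewrite (le_lt_trans (ler_normD _ _))// (_ : e * t = t * e / 2 + t * e / 2); last by field.
  rewrite ltrD// normrZ ger0_norm ?subr_ge0//.
  by rewrite (le_lt_trans _ yy')// ler_piMl// gerBl ltW.
have Az : A (t *: x + (1 - t) *: y).
  by have := H 0; rewrite addr0 normr0; apply => //; exact: lin0.
by apply/(riP Az); exists (t * e / 2).
Qed.

Lemma ri_prolong A x y : ri A x -> A y ->
  exists2 e : R, 0 < e & A (x + e *: (x - y)).
Proof.
move=> xA Ay; have Ax := ri_sub xA; move/(riP Ax) : xA => [e e0 Ae].
have n0 : 0 < `|x - y| + 1 by rewrite ltr_wpDl.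
exists (e / (`|x - y| + 1)); first by rewrite divr_gt0.
apply: Ae; first by apply: linZ; [exists x|exact: lin_sub].
rewrite normrZ gtr0_norm ?divr_gt0// mulrAC ltr_pdivrMr// ltr_pM2l//.
by rewrite ltrDl.
Qed.

Lemma prolongE x y (e : R) : 0 < e ->
  x = (e / (1 + e)) *: y + (1 - e / (1 + e)) *: (x + e *: (x - y)).
Proof.
move=> e0; have e1 : 1 + e != 0 by rewrite lt0r_neq0// addr_gt0.
apply/rowP => i; rewrite !mxE; field.
exact: e1.
Qed.

(** Prolonging from a relative interior point [z] through [x] puts [x] strictly before the far end
    of a segment issuing from [z]. With [ri_prolong] this describes [ri] without topology. *)
Lemma prolong_ri A x : convex_set A -> A x ->
  (forall y, A y -> exists2 e : R, 0 < e & A (x + e *: (x - y))) -> ri A x.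
Proof.
move=> cA Ax Ap; have [|z zA] := ri_nonempty cA; first by exists x.
have [e e0 Ae] := Ap _ (ri_sub zA); rewrite (prolongE x z e0).
apply: ri_segment => //; first exact: subset_closure.
by rewrite divr_gt0 ?addr_gt0//= ler_pdivrMr ?addr_gt0// mul1r lerDr.
Qed.

(** Prolong from a point [z] of [ri A] through [x] to a point of the closure; [ri_segment] then puts
    [x] in [ri A]. *)
Lemma ri_closure_sub A B : convex_set A -> closure A = B -> ri B `<=` A.
Proof.
move=> cA AB x xB; have A0 : A !=set0.
  apply/set0P/eqP => A0; have := ri_sub xB.
  by rewrite -AB A0 closure0.
have [z zA] := ri_nonempty cA A0.
have [|e e0 Be] := ri_prolong xB (_ : B z).
  by rewrite -AB; apply: subset_closure; exact: ri_sub.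
apply: ri_sub; rewrite (prolongE x z e0); apply: ri_segment => //.
  by rewrite AB.
by rewrite divr_gt0 ?addr_gt0//= ler_pdivrMr ?addr_gt0// mul1r lerDr.
Qed.

Lemma closure_ri A : convex_set A -> closure (ri A) = closure A.
Proof.
move=> cA; apply/seteqP; split; first by apply: closure_subset; exact: ri_sub.
move=> y yA; have A0 : A !=set0.
  by have [x [Ax _]] := yA setT filterT; exists x.
have [x xA] := ri_nonempty cA A0; rewrite closureEcvg.
(* Approach [y] along the segment from a relative interior point. *)
exists ((fun n : nat => n.+1%:R^-1 *: x + (1 - n.+1%:R^-1) *: y) @ \oo).
  exact: fmap_proper_filter.
split; last first.
  move=> U Uri; rewrite /fmap/=; near=> n; apply: Uri; apply: ri_segment => //.
  by rewrite invr_gt0 ltr0n/= invf_le1 ?ltr0n// ler1n.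
rewrite -[X in _ --> X]add0r -[X in 0 + X]scale1r -(scale0r x) -[X in X *: y]subr0.
apply: cvgD; apply: cvgZl; last apply: cvgB; try exact: cvg_cst.
- exact: cvg_harmonic.
- exact: cvg_harmonic.
Unshelve. all: by end_near. Qed.

Lemma convex_image A m (P : 'M[R]_(d, m)) : convex_set A ->
  convex_set [set x *m P | x in A].
Proof.
move=> /convex_setP cA x y t; rewrite !inE => -[x' Ax' <-] [y' Ay' <-].
exists (t%:num *: x' + (1 - t%:num) *: y'); last by rewrite mulmxDl -!scalemxAl.
by apply: cA => //; rewrite ge0/= le1.
Qed.

End relative_interior.

(** Prolongations map to prolongations. Conversely, prolong [y] from the image of a point [z] of
    [ri A] to the image of some [w] in [A]; the matching point between [z] and [w] is a preimage in
    [ri A]. *)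
Lemma ri_image (R : realType) (d m : nat) (A : set 'rV[R]_d) (P : 'M[R]_(d, m)) :
  convex_set A ->
  [set x *m P | x in ri A] = ri [set x *m P | x in A].
Proof.
move=> cA; apply/seteqP; split=> [_ [x xA <-]|y yA].
  apply: prolong_ri; first exact: convex_image.
    by exists x => //; exact: ri_sub.
  move=> _ [y Ay <-]; have [e e0 Ae] := ri_prolong xA Ay; exists e => //.
  by exists (x + e *: (x - y)) => //; rewrite mulmxDl -scalemxAl mulmxBl.
have A0 : A !=set0 by have [x Ax _] := ri_sub yA; exists x.
have [z zA] := ri_nonempty cA A0.
have [|e e0 [w Aw we]] := ri_prolong yA (_ : _ (z *m P)).
  by exists z => //; exact: ri_sub.
rewrite (prolongE y (z *m P) e0) -we.
exists ((e / (1 + e)) *: z + (1 - e / (1 + e)) *: w); last first.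
  by rewrite mulmxDl -!scalemxAl.
apply: ri_segment => //; first exact: subset_closure.
by rewrite divr_gt0 ?addr_gt0//= ler_pdivrMr ?addr_gt0// mul1r lerDr.
Qed.

(** * Convex cores *)

Section borel.
Context {R : realType} {d : nat}.
Local Notation E := 'rV[R]_d.
Implicit Types (U C : set E).

Lemma open_measurable_rV U : open U -> measurable U.
Proof. by move=> oU; exact: sub_gen_smallest. Qed.

Lemma closed_measurable_rV C : closed C -> measurable C.
Proof.
move=> cC; rewrite -(setCK C); apply: measurableC; apply: open_measurable_rV.
exact: closed_openC.
Qed.

Lemma closure_measurable_rV U : measurable (closure U).
Proof. by apply: closed_measurable_rV; exact: closed_closure. Qed.

Lemma continuous_measurable_rV (f : E -> R) : continuous f -> measurable_fun setT f.
Proof.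
move=> cf; apply: (measurability _ (RGenOpens.measurableE R)).
move=> _ [_ [a [b ->] <-]]; rewrite setTI; apply: open_measurable_rV.
apply: open_comp; [by move=> x _; exact: cf|exact: interval_open].
Qed.

Lemma measurable_dot (u : E) : measurable_fun setT (dot u).
Proof. by apply: continuous_measurable_rV; exact: continuous_dot. Qed.

Lemma dense_ratr_ball (x : E) (e : R) : 0 < e ->
  exists q : 'rV[rat]_d, ball x e (map_mx ratr q : E).
Proof.
move=> e0; have /choice[q qP] : forall i, exists q : rat, x 0 i - e < ratr q < x 0 i + e.
  move=> i; have /rat_in_itvoo[q] : x 0 i - e < x 0 i + e by lra.
  by rewrite in_itv/=; exists q.
exists (\row_i q i); split => // i j; rewrite !mxE (ord1 i) /ball/= ltr_distlC.
by rewrite qP.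
Qed.

(** Lindelöf argument: every point of the union lies in a ball with rational centre and radius 1 /
    (n + 1) inside a single [G i], and such balls are countably many. *)
Lemma negligible_open_bigcup (mu : {measure set E -> \bar R}) (B : set E)
    (I : Type) (D : set I) (G : I -> set E) :
  (forall i, D i -> open (G i)) -> (forall i, D i -> mu.-negligible (B `&` G i)) ->
  mu.-negligible (B `&` \bigcup_(i in D) G i).
Proof.
move=> oG nG.
pose Q (k : nat) : set E := if unpickle k is Some qn then
  ball (map_mx ratr (qn : 'rV[rat]_d * nat).1 : E) (qn.2.+1%:R^-1 : R) else set0.
pose S k := [set x | B x /\ Q k x /\ exists2 i, D i & Q k `<=` G i].
apply: (@negligibleS _ _ _ mu (\bigcup_k S k)).
  move=> x [Bx [i Di Gx]]; have /nbhs_ballP[e /= e0 xe] : nbhs x (G i).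
    by apply: open_nbhs_nbhs; split => //; exact: oG.
  (* The radius is used twice: to reach the rational centre from [x], then to cross the ball. *)
  have [n ne] : exists n : nat, n.+1%:R^-1 + n.+1%:R^-1 <= e.
    have e2 : 0 < e / 2 by lra.
    have [n /ltW ne] := ltr_add_invr e2.
    by exists n; move: ne; rewrite add0r; move: (n.+1%:R^-1) => r; lra.
  have [|q xq] := @dense_ratr_ball x n.+1%:R^-1; first by rewrite invr_gt0 ltr0n.
  exists (pickle (q, n)) => //; split => //; rewrite /Q pickleK/=; split.
    exact: ball_sym.
  exists i => // y qy; apply: xe; apply: le_ball ne _ _.
  exact: ball_triangle qy.
apply: negligible_bigcup => k.
have [[i Di QG]|nG'] := pselect (exists2 i, D i & Q k `<=` G i).
  by apply: negligibleS (nG i Di) => x [Bx [Qx _]]; split => //; exact: QG.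
rewrite (_ : S k = set0); first exact: negligible_set0.
by apply/seteqP; split => // x [_ [_]].
Qed.

End borel.

#[local] Hint Resolve closure_measurable_rV : core.

Section convex_core.
Context {R : realType} {d : nat}.
Local Notation E := 'rV[R]_d.
Context (mu : {finite_measure set E -> \bar R}).
Implicit Types (B C F : set E).

(* The convex core of the restriction of mu to B. *)
Definition core_on B : set E := \bigcap_(C in
  [set C : set E | [/\ measurable C, convex_set C & mu.-negligible (B `\` C)]]) C.

(** Finiteness of [mu] allows cancelling [mu C]. The negligible form is the one that relativizes to
    a set [B]. *)
Lemma negligible_setC C : measurable C ->
  mu.-negligible (~` C) <-> mu C = mu setT.
Proof.
move=> mC; have mu_fin A : measurable A -> mu A \is a fin_num.
  by move=> mA; exact: fin_num_measure.
rewrite (negligibleP mu (measurableC mC)).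
have -> : mu setT = (mu C + mu (~` C))%E.
  rewrite -measureU//; [by rewrite setUv|exact: measurableC|by rewrite setICr].
split=> [->|]; first by rewrite adde0.
rewrite -(fineK (mu_fin C mC)) -(fineK (mu_fin _ (measurableC mC))) -EFinD => -[h].
suff h0 : fine (mu (~` C)) = 0 by have := fineK (mu_fin _ (measurableC mC)); rewrite h0 => /esym.
lra.
Qed.

Lemma cc_core_on : cc mu = core_on setT.
Proof.
rewrite /cc /core_on; congr bigcap; apply/seteqP; split=> C /= [mC cC].
  by move=> /(negligible_setC mC); rewrite -setTD.
by rewrite setTD => /(negligible_setC mC).
Qed.

Lemma convex_core_on B : convex_set (core_on B).
Proof. by apply: convex_bigcap => C []. Qed.

Lemma core_on_negligible B : mu.-negligible B -> core_on B = set0.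
Proof.
move=> B0; apply/seteqP; split => // x /(_ set0); apply; split; first exact: measurable0.
- exact/convex_setP.
- by rewrite setD0.
Qed.

Lemma core_on_eq B B' : B' `<=` B -> mu.-negligible (B `\` B') ->
  core_on B = core_on B'.
Proof.
move=> B'B BB'; congr bigcap; apply/seteqP; split => C /= [mC cC nC]; split => //.
  by apply: negligibleS nC; exact: setSD.
apply: negligibleS (negligibleU BB' nC) => x [Bx Cx].
by have [B'x|B'x] := pselect (B' x); [right|left].
Qed.

Lemma convex_closure C : convex_set C -> convex_set (closure C).
Proof.
move=> /convex_setP cC; apply/convex_setP => x y t xC yC /andP[t0 t1].
move=> U /nbhs_ballP[e /= e0 eU].
have [x' [Cx' xx']] := xC _ (nbhsx_ballx x _ e0).
have [y' [Cy' yy']] := yC _ (nbhsx_ballx y _ e0).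
exists (t *: x' + (1 - t) *: y'); split; first by apply: cC => //; rewrite t0.
apply: eU; move: xx' yy'; rewrite -!ball_normE /ball_/= => xx' yy'.
rewrite opprD addrACA -!scalerBr (le_lt_trans (ler_normD _ _))// !normrZ.
rewrite !ger0_norm ?subr_ge0//.
have [->|t1'] := eqVneq t 0; first by rewrite subr0 mul0r mul1r add0r.
have {}t0 : 0 < t by rewrite lt_neqAle eq_sym t1'.
have : t * `|x - x'| < t * e by rewrite ltr_pM2l.
have : (1 - t) * `|y - y'| <= (1 - t) * e by rewrite ler_wpM2l ?subr_ge0// ltW.
lra.
Qed.

(* If C is convex Borel and carries the mass of B, then C meets the support of
   that mass in a convex set dense in the support, hence contains its relative
   interior. *)
Lemma negligible_core_on B : mu.-negligible (B `\` closure (core_on B)).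
Proof.
pose D := [set C : set E | [/\ closed C, convex_set C & mu.-negligible (B `\` C)]].
pose S := \bigcap_(C in D) C.
(* The complement of [S] is a union, possibly uncountable, of open sets each negligible within
   [B]. *)
have BS : mu.-negligible (B `\` S).
  rewrite setDE /S setC_bigcap; apply: negligible_open_bigcup => C [cC _ nC].
    exact: closed_openC.
  by rewrite -setDE.
have cS : closed S by apply: closed_bigI => C [].
have vS : convex_set S by apply: convex_bigcap => C [].
have riS : ri S `<=` core_on B.
  move=> x xS C [mC vC nC].
  have vCS : convex_set (C `&` S) by exact: convex_setI.
  suff : closure (C `&` S) = S by move=> /(ri_closure_sub vCS)/(_ _ xS)[].
  apply/seteqP; split.
    by rewrite [X in _ `<=` X](closure_id _).1//; exact: closure_subset.
  (* The closure of [C] cut with [S] is itself one of the sets intersected in [S]. *)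
  apply: bigcap_inf; split; [exact: closed_closure|exact: convex_closure|].
  apply: negligibleS (negligibleU nC BS) => y [By yCS].
  have [Cy|Cy] := pselect (C y); [right|by left]; split => // Sy.
  by apply: yCS; exact: subset_closure.
apply: negligibleS BS; apply: setDS.
rewrite [X in X `<=` _](closure_id _).1// -(closure_ri vS).
exact: closure_subset.
Qed.

End convex_core.

(** * Faces of the convex core *)

Section faces.
Context {R : realType} {d : nat}.
Local Notation E := 'rV[R]_d.
Implicit Types (B C F G : set E) (tau x y a : E).

Lemma closed_dot_le tau (k : R) : closed [set x : E | dot tau x <= k].
Proof.
rewrite (_ : mkset _ = dot tau @^-1` [set r : R | r <= k])//.
apply: closed_comp; last exact: closed_le.
by move=> x _; exact: continuous_dot.
Qed.

Lemma closed_dot_eq tau (k : R) : closed [set x : E | dot tau x = k].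
Proof.
rewrite (_ : mkset _ = dot tau @^-1` [set r : R | r = k])//.
apply: closed_comp; last exact: closed_eq.
by move=> x _; exact: continuous_dot.
Qed.

Lemma closure_dot_le F tau (k : R) : (forall x, F x -> dot tau x <= k) ->
  forall x, closure F x -> dot tau x <= k.
Proof.
move=> Fk x Fx; have := closure_subset (Fk : F `<=` [set x | dot tau x <= k]) Fx.
by rewrite -(closure_id _).1//; exact: closed_dot_le.
Qed.

Lemma convex_dot_eq tau (k : R) : convex_set [set x : E | dot tau x = k].
Proof.
by apply/convex_setP => x y t /= xk yk _; rewrite dotDr !dotZr xk yk; ring.
Qed.

Lemma is_face_refl C : C !=set0 -> convex_set C -> is_face C C.
Proof. by move=> C0 cC; split. Qed.

Lemma is_face_trans C F G : is_face C F -> is_face F G -> is_face C G.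
Proof.
move=> [F0 cF FC Fface] [G0 cG GF Gface]; split => //; first exact: subset_trans FC.
move=> x y t Cx Cy t01 Gxy; have [Fx Fy] := Fface _ _ _ Cx Cy t01 (GF _ Gxy).
exact: Gface Gxy.
Qed.

(** Two nonpositive numbers with positive weights have sum zero only if both vanish. *)
Lemma exposed_is_face F tau a : F a -> convex_set F ->
  (forall x, F x -> dot tau (x - a) <= 0) ->
  is_face F (F `&` [set x | dot tau (x - a) = 0]).
Proof.
move=> Fa /convex_setP cF Fle; split => //.
- by exists a; split => //=; rewrite subrr dotC dotE mul0mx mxE.
- apply/convex_setP => x y t [Fx /= tx] [Fy /= ty] t01; split; first exact: cF.
  by move: tx ty; rewrite /= !dotBr dotDr !dotZr => tx ty; nra.
- move=> x y t Fx Fy /andP[t0 t1] [_ /=] txy.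
  have tx := Fle _ Fx; have ty := Fle _ Fy.
  have {}txy : t * dot tau (x - a) + (1 - t) * dot tau (y - a) = 0.
    by rewrite -txy !dotBr dotDr !dotZr; ring.
  have t1' : 0 < 1 - t by rewrite subr_gt0.
  by split; split => //=; nra.
Qed.

(** The face is proper: otherwise [tau] would be orthogonal to [lin F], hence to itself. *)
Lemma exposed_exposes F tau a : F a -> convex_set F -> l2norm tau = 1 ->
  lin F tau -> (forall x, F x -> dot tau (x - a) <= 0) ->
  exposes F tau (F `&` [set x | dot tau (x - a) = 0]).
Proof.
move=> Fa cF tau1 Ltau Fle; split => //; last by exists a.
split; first exact: exposed_is_face.
move=> FE; have : dot tau tau = 0.
  apply: (lin_dot0 Fa) Ltau => x Fx.
  have : (F `&` [set x | dot tau (x - a) = 0]) x by rewrite FE.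
  by case.
by move=> t0; move/eqP: tau1; rewrite /l2norm t0 sqrtr0 eq_sym oner_eq0.
Qed.

Context (mu : {finite_measure set E -> \bar R}).

Section supporting_hyperplane.
Context (F : set E) (tau : E) (k : R) (coreF : F = core_on mu (closure F)).
Context (Fk : forall x, F x -> dot tau x <= k).
Let H := [set x : E | dot tau x = k].

(* Adjoining the open half-space below H turns a convex set that is full on
   the part of cl F in H into one that is full on cl F. *)
Lemma core_on_supporting : core_on mu (closure F `&` H) = F `&` H.
Proof.
apply/seteqP; split.
  move=> x xF; split.
    rewrite coreF => C [mC cC nC]; apply: xF; split => //.
    by apply: negligibleS nC => y [[Fy _] Cy].
  apply: xF; split; [|exact: convex_dot_eq|].
    by apply: closed_measurable_rV; exact: closed_dot_eq.
  by apply: negligibleS (negligible_set0 _) => y [[_ Hy]].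
move=> x [Fx Hx] C [mC cC nC]; move: Fx; rewrite coreF.
pose L := [set x : E | dot tau x < k].
have mL : measurable L.
  apply: open_measurable_rV; rewrite (_ : L = dot tau @^-1` [set r : R | r < k])//.
  by apply: open_comp; [move=> y _; exact: continuous_dot|exact: open_lt].
move=> /(_ ((C `&` H) `|` L))[]; [split|by case|by rewrite /L/= Hx ltxx].
- apply: measurableU => //; apply: measurableI => //.
  by apply: closed_measurable_rV; exact: closed_dot_eq.
- move/convex_setP : cC => cC; apply/convex_setP => y z t yCL zCL t01.
  have yk : dot tau y <= k by case: yCL => [[_ ->]|/ltW].
  have zk : dot tau z <= k by case: zCL => [[_ ->]|/ltW].
  have [tyz|tyz] := ltP (dot tau (t *: y + (1 - t) *: z)) k; first by right.
  (* The point is not in the open half-space; unless it is an endpoint, both ends must then lie on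
     [H]. *)
  move: tyz; rewrite dotDr !dotZr => tyz; move/andP : (t01) => [t0 t1].
  have [t00|t0'] := eqVneq t 0.
    by move: zCL; rewrite t00 scale0r subr0 scale1r add0r.
  have [t11|t1'] := eqVneq t 1.
    by move: yCL; rewrite t11 scale1r subrr scale0r addr0.
  have {}t0 : 0 < t by rewrite lt_neqAle eq_sym t0'.
  have {}t1 : 0 < 1 - t by rewrite subr_gt0 lt_neqAle t1'.
  have ty : dot tau y = k by nra.
  have tz : dot tau z = k by nra.
  left; split; last by rewrite /H/= dotDr !dotZr ty tz; ring.
  apply: cC => //.
    by case: yCL => [[]//|]; rewrite /L/= ty ltxx.
  by case: zCL => [[]//|]; rewrite /L/= tz ltxx.
- apply: negligibleS nC => y [Fy yCL].
  have yk := closure_dot_le Fk Fy.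
  have Hy : H y.
    apply/eqP; rewrite eq_le yk /= leNgt; apply/negP => yk'; apply: yCL.
    by right.
  by split => // Cy; apply: yCL; left.
Qed.

Lemma negligible_supporting :
  mu.-negligible ((closure F `&` H) `\` closure (F `&` H)).
Proof. by rewrite -core_on_supporting; exact: negligible_core_on. Qed.

Lemma closure_supporting : closure (F `&` H) `<=` closure F `&` H.
Proof.
have cFH : closed (closure F `&` H).
  by apply: closedI; [exact: closed_closure|exact: closed_dot_eq].
rewrite [X in _ `<=` X](closure_id _).1//; apply: closure_subset.
by apply: setSI; exact: subset_closure.
Qed.

(** The set cl(F) cut with [H] has core [F] cut with [H], and shrinking it to the closure of that
    core loses only negligible mass. Thus exposed faces inherit the property [coreF]. *)
Lemma core_on_face : F `&` H = core_on mu (closure (F `&` H)).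
Proof.
rewrite -{1}core_on_supporting; apply: core_on_eq.
  exact: closure_supporting.
exact: negligible_supporting.
Qed.

End supporting_hyperplane.

(** Gives positive normalizing constants for the laws on faces. *)
Lemma core_on_nonnegligible F : F = core_on mu (closure F) -> F !=set0 ->
  ~ mu.-negligible (closure F).
Proof.
by move=> coreF /set0P/eqP F0 nF; apply: F0; rewrite coreF core_on_negligible.
Qed.

Lemma cc_core_on_closure : cc mu = core_on mu (closure (cc mu)).
Proof.
rewrite {1}cc_core_on; apply: core_on_eq => //.
by rewrite cc_core_on; exact: negligible_core_on.
Qed.

Lemma exposes_lin F tau G : exposes F tau G ->
  [/\ F !=set0, G !=set0, lin G `<=` lin F, lin F tau &
      forall u, lin G u -> dot tau u = 0].
Proof.
move=> [_ Ltau [[G0 _ GF _] _] [a [Fa _ GE]]]; split => //.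
- by exists a.
- exact: lin_subset.
- have Ga : G a by rewrite GE; split => //=; rewrite subrr dotC dotE mul0mx mxE.
  by apply: (lin_dot0 Ga) => x; rewrite GE => -[].
Qed.

Lemma exposesE F tau G : exposes F tau G -> exists k : R,
  (forall x, F x -> dot tau x <= k) /\ G = F `&` [set x | dot tau x = k].
Proof.
move=> [_ _ _ [a [Fa Fle ->]]]; exists (dot tau a); split.
  by move=> x /Fle; rewrite dotBr subr_le0.
congr (_ `&` _); apply/seteqP; split => x /=; rewrite dotBr.
  by move/eqP; rewrite subr_eq0 => /eqP.
by move=> ->; rewrite subrr.
Qed.

(** [core_on_face] propagates the property down the chain, starting from [cc_core_on_closure]. *)
Lemma access_chain_core F (taus : seq E) (F_ : nat -> set E) :
  access_chain (cc mu) F taus F_ ->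
  forall i, (i <= size taus)%N -> F_ i = core_on mu (closure (F_ i)).
Proof.
move=> [F0 _ Fexp]; elim=> [_|i IH isize].
  by rewrite F0; exact: cc_core_on_closure.
have [k [Fk ->]] := exposesE (Fexp _ isize).
by apply: core_on_face => //; apply: IH; exact: ltnW.
Qed.

End faces.

(** * Total variation and densities *)

Section total_variation.
Context {disp : measure_display} {T : measurableType disp} {R : realType}.
Implicit Types (P Q : probability T R) (A : set T).

Lemma total_variation_ge (nu : {charge set T -> \bar R}) A : measurable A ->
  (`|nu A| <= Defs.total_variation nu)%E.
Proof.
move=> mA; rewrite /Defs.total_variation.
case: (cid (Hahn_decomposition nu)) => X exN /=; case: (cid _) => Y nuXY /=.
apply: le_trans (abse_charge_variation nuXY mA) _.
by apply: le_measure; rewrite ?inE.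
Qed.

(** The variation is the sum of the absolute values on the positive and the negative Hahn set, each
    at most [e]. *)
Lemma total_variation_le (nu : {charge set T -> \bar R}) (e : \bar R) :
  (forall A, measurable A -> (`|nu A| <= e)%E) -> (Defs.total_variation nu <= e + e)%E.
Proof.
move=> nue; rewrite /Defs.total_variation.
case: (cid (Hahn_decomposition nu)) => X exN /=; case: (cid _) => Y nuXY /=.
rewrite /charge_variation/= jordan_posE jordan_negE cjordan_posE cjordan_negE.
have [[mP _] [mN _] _ _] := nuXY.
apply: leeD; rewrite /crestr0 mem_set//= /crestr setTI.
  by apply: le_trans (nue _ mP); exact: lee_abs.
by apply: le_trans (nue _ mN); rewrite -abseN; exact: lee_abs.
Qed.

Lemma variation_distance_ge P Q A : measurable A ->
  (`|P A - Q A| <= variation_distance P Q)%E.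
Proof.
move=> mA; apply: le_trans (total_variation_ge _ mA).
by rewrite /= /cadd/= /copp/=.
Qed.

Lemma variation_distance_le P Q (e : \bar R) :
  (forall A, measurable A -> (`|P A - Q A| <= e)%E) ->
  (variation_distance P Q <= e + e)%E.
Proof. by move=> PQe; apply: total_variation_le => A /PQe. Qed.

Lemma cl_vP (S : set (probability T R)) P : cl_v S P <->
  forall e : R, 0 < e -> exists2 Q, S Q &
    forall A, measurable A -> (`|P A - Q A| <= e%:E)%E.
Proof.
split=> [[Q SQ] PQ0 e e0|Pe].
  have [n _ /(_ n)] : \forall n \near \oo, (variation_distance P (Q n) < e%:E)%E.
    have e0' : (0 < e%:E)%E by rewrite lte_fin.
    exact: PQ0 (open_ereal_lt' e0').
  move=> /(_ (leqnn n)) PQe; exists (Q n) => // A mA.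
  by apply: le_trans (ltW PQe); exact: variation_distance_ge.
have /choice[Q QP] : forall n, exists Q, S Q /\
    forall A, measurable A -> (`|P A - Q A| <= n.+1%:R^-1%:E)%E.
  by move=> n; have [|Q ? ?] := Pe n.+1%:R^-1; [rewrite invr_gt0|exists Q].
exists Q; first by move=> n; have [] := QP n.
apply: (@squeeze_cvge _ _ _ _ (cst 0%E) _ (fun n => (n.+1%:R^-1 + n.+1%:R^-1)%:E)).
- apply: nearW => n; rewrite EFinD variation_distance_le ?andbT; last first.
    by have [] := QP n.
  exact: le_trans (abse_ge0 _) (variation_distance_ge P (Q n) measurable0).
- exact: cvg_cst.
- apply: cvg_EFin; first exact: nearW.
  rewrite -[X in _ --> X]addr0; apply: cvgD; exact: cvg_harmonic.
Qed.

End total_variation.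

Section probability_of_density.
Context {disp : measure_display} {T : measurableType disp} {R : realType}.
Context (mu : {measure set T -> \bar R}) (f : T -> R).
Context (mf : measurable_fun setT f) (f0 : forall x, 0 <= f x).
Context (f1 : (\int[mu]_x (f x)%:E = 1)%E).

(* The proofs are arguments only to let the constant carry its canonical
   probability structure. *)
Definition density_measure of measurable_fun setT f & (forall x, 0 <= f x) &
  (\int[mu]_x (f x)%:E = 1)%E : set T -> \bar R := fun A => (\int[mu]_(x in A) (f x)%:E)%E.

Local Notation nu := (density_measure mf f0 f1).

Let nu0 : nu set0 = 0%E.
Proof. exact: integral_set0. Qed.

Let nu_ge0 A : (0 <= nu A)%E.
Proof. by apply: integral_ge0 => x _; rewrite lee_fin. Qed.

Let nu_sigma_additive : semi_sigma_additive nu.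
Proof.
apply: semi_sigma_additive_nng_induced; first exact/measurable_EFinP.
by move=> x; rewrite lee_fin.
Qed.

HB.instance Definition _ := isMeasure.Build _ _ _ nu nu0 nu_ge0 nu_sigma_additive.

HB.instance Definition _ := Measure_isProbability.Build _ _ _ nu f1.

Lemma ex_probability_density : exists P : probability T R,
  forall A, P A = (\int[mu]_(x in A) (f x)%:E)%E.
Proof. by exists nu. Qed.

End probability_of_density.

(** * Laws given by unnormalized densities *)

Section normalized_density.
Context {disp : measure_display} {T : measurableType disp} {R : realType}.
Context (mu : {measure set T -> \bar R}).
Implicit Types (f h : T -> R) (A : set T).

(** Invariance under scaling of [f] lets densities be multiplied by convenient constants before
    limits are taken. *)
Definition normalized f A : R := (\int[mu]_(x in A) f x) / (\int[mu]_x f x).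

Lemma Rintegral_le_subset f A : measurable A -> mu.-integrable setT (EFin \o f) ->
  (forall x, 0 <= f x) -> \int[mu]_(x in A) f x <= \int[mu]_x f x.
Proof.
move=> mA intf f0; have mf : measurable_fun setT (EFin \o f) by exact: measurable_int intf.
apply: fine_le; [exact/integrable_fin_num/(integrableS measurableT)|
  exact: integrable_fin_num|].
by apply: ge0_subset_integral => // x _; rewrite lee_fin.
Qed.

Lemma normalized_dist f h A (e : R) : measurable A ->
  mu.-integrable setT (EFin \o f) -> mu.-integrable setT (EFin \o h) ->
  (forall x, 0 <= h x) ->
  0 < \int[mu]_x f x -> 0 < \int[mu]_x h x ->
  \int[mu]_x `|h x - f x| <= e ->
  `|normalized h A - normalized f A| <= 2 * e / \int[mu]_x f x.
Proof.
move=> mA intf inth h0 F0 H0 fhe.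
have intd : mu.-integrable setT (EFin \o (fun x => h x - f x)).
  by rewrite (_ : _ \o _ = (EFin \o h) \- (EFin \o f))%E//; exact: integrableB.
have dist B : measurable B -> `|\int[mu]_(x in B) h x - \int[mu]_(x in B) f x| <= e.
  move=> mB; have intS g : mu.-integrable setT (EFin \o g) -> mu.-integrable B (EFin \o g).
    exact: integrableS.
  rewrite -RintegralB//; [|exact: intS..].
  rewrite (le_trans _ fhe)// (le_trans (le_normr_Rintegral mB (intS _ intd)))//.
  apply: Rintegral_le_subset => //.
  exact: integrable_norm.
rewrite /normalized.
have := dist _ mA; have := dist _ measurableT.
have := Rintegral_le_subset mA inth h0.
have : 0 <= \int[mu]_(x in A) h x by exact: Rintegral_ge0.
move: (\int[mu]_x f x) F0 (\int[mu]_x h x) H0 => s s0 s' s'0.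
move: (\int[mu]_(x in A) f x) (\int[mu]_(x in A) h x) => u u' u'0 u's' se ue.
(* Both terms of the numerator are at most [e], since u' / s' is at most 1. *)
rewrite (_ : u' / s' - u / s = ((u' - u) + u' / s' * (s - s')) / s); last first.
  by field; rewrite !gt_eqF.
rewrite normrM [X in _ * X]gtr0_norm ?invr_gt0// ler_pM2r ?invr_gt0//.
rewrite (le_trans (ler_normD _ _))// (_ : 2 * e = e + e); last by ring.
apply: lerD => //; rewrite normrM distrC -[leRHS]mul1r.
have q0 : 0 <= u' / s' by rewrite divr_ge0// ltW.
apply: ler_pM => //; rewrite ger0_norm//.
by rewrite ler_pdivrMr// mul1r.
Qed.

(** Dominated convergence gives convergence in mean, which bounds the distance uniformly over
    events. *)
Lemma normalized_cvg (f_ : nat -> T -> R) f (g : T -> R) :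
  (forall n, measurable_fun setT (f_ n)) -> measurable_fun setT f ->
  (forall n x, 0 <= f_ n x <= g x) ->
  mu.-integrable setT (EFin \o g) ->
  {ae mu, forall x, f_ ^~ x @ \oo --> f x} ->
  (forall n, 0 < \int[mu]_x f_ n x) -> 0 < \int[mu]_x f x ->
  forall e : R, 0 < e -> exists n, forall A, measurable A ->
    `|normalized (f_ n) A - normalized f A| <= e.
Proof.
move=> mf_ mf f_g intg f_f F_0 F0 e e0.
have [] := @dominated_convergence _ T R mu setT measurableT
  (fun n => EFin \o f_ n) (EFin \o f) (EFin \o g).
- by move=> n; exact/measurable_EFinP.
- exact/measurable_EFinP.
- apply: filterS f_f => x f_f _; apply: cvg_EFin; first exact: nearW.
  exact: f_f.
- by [].
- apply: aeW => x n _ /=; rewrite lee_fin.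
  by have /andP[? ?] := f_g n x; rewrite ger0_norm.
move=> intf f_f0 _.
have intf_ n : mu.-integrable setT (EFin \o f_ n).
  apply: le_integrable intg => //; first exact/measurable_EFinP.
  move=> x _; rewrite lee_fin; have /andP[? ?] := f_g n x.
  by rewrite !ger0_norm// (le_trans _ (_ : f_ n x <= _)).
(* Chosen so that the bound of [normalized_dist] is exactly [e]. *)
have e2 : 0 < e * \int[mu]_x f x / 2 by rewrite divr_gt0// mulr_gt0.
have e2' : (0 < (e * \int[mu]_x f x / 2)%:E)%E by rewrite lte_fin.
have [n _ /(_ n (leqnn n)) /= f_fn] := f_f0 _ (open_ereal_lt' e2').
exists n => A mA; have := @normalized_dist f (f_ n) A (e * \int[mu]_x f x / 2) mA intf (intf_ n).
rewrite (_ : 2 * _ / _ = e); last by field; rewrite gt_eqF.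
apply => //; first by move=> x; have /andP[] := f_g n x.
rewrite -lee_fin; apply: le_trans (ltW f_fn); rewrite /Rintegral fineK//.
have : mu.-integrable setT (EFin \o (fun x => f_ n x - f x)).
  by rewrite (_ : _ \o _ = (EFin \o f_ n) \- (EFin \o f))%E//; exact: integrableB.
by move=> /integrable_norm/integrable_fin_num; apply.
Qed.

End normalized_density.

(** * Exponential densities *)

Section exponential_density.
Context {R : realType} {d : nat}.
Local Notation E := 'rV[R]_d.
Context (mu : {finite_measure set E -> \bar R}).
Implicit Types (B F A : set E) (theta x : E).

(** Extension by zero puts the densities on different faces on one common space. *)
Definition exp_dens B theta : E -> R := (fun x => expR (dot theta x)) \_ B.

Lemma exp_densE B theta x : B x -> exp_dens B theta x = expR (dot theta x).
Proof. by move=> Bx; rewrite /exp_dens patchE mem_set. Qed.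

Lemma exp_dens0 B theta x : ~ B x -> exp_dens B theta x = 0.
Proof. by move=> Bx; rewrite /exp_dens patchE memNset. Qed.

Lemma exp_dens_ge0 B theta x : 0 <= exp_dens B theta x.
Proof.
have [Bx|Bx] := pselect (B x); first by rewrite exp_densE// expR_ge0.
by rewrite exp_dens0.
Qed.

Lemma measurable_expR_dot theta : measurable_fun setT (fun x => expR (dot theta x)).
Proof. by apply: measurableT_comp => //; exact: measurable_dot. Qed.

Lemma measurable_exp_dens B theta : measurable B ->
  measurable_fun setT (exp_dens B theta).
Proof.
move=> mB; apply/(measurable_restrictT _ mB); apply: measurable_funTS.
exact: measurable_expR_dot.
Qed.

Lemma integral_exp_dens B theta A :
  (\int[mu]_(x in A `&` B) (expR (dot theta x))%:E =
   \int[mu]_(x in A) (exp_dens B theta x)%:E)%E.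
Proof.
rewrite integral_mkcondr; apply: eq_integral => x _.
by rewrite -[LHS]/(((EFin \o (fun x => expR (dot theta x))) \_ B) x) restrict_EFin.
Qed.

Lemma dom_integrable B theta : measurable B ->
  dom_log_laplace mu B theta <-> mu.-integrable setT (EFin \o exp_dens B theta).
Proof.
move=> mB; rewrite /dom_log_laplace/= /log_laplace -[in X in X <-> _](setTI B).
rewrite integral_exp_dens.
have absE : (\int[mu]_x `|(EFin \o exp_dens B theta) x| =
             \int[mu]_x (exp_dens B theta x)%:E)%E.
  apply: eq_integral => x _ /=; rewrite ger0_norm//; exact: exp_dens_ge0.
split=> [Zoo|/integrableP[_]].
  apply/integrableP; split; first by apply/measurable_EFinP; exact: measurable_exp_dens.
  rewrite absE; move: Zoo; case: (\int[mu]_x _)%E => [r _| |_] //=.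
  exact: ltry.
rewrite absE; case: (\int[mu]_x _)%E => [r _|//|//] /=.
by case: ifP => _; rewrite ?ltNyy ?ltry.
Qed.

Lemma dom_subset B B' theta : measurable B -> measurable B' -> B `<=` B' ->
  dom_log_laplace mu B' theta -> dom_log_laplace mu B theta.
Proof.
move=> mB mB' BB' /(dom_integrable _ mB') i; apply/(dom_integrable _ mB).
apply: le_integrable i => //; first by apply/measurable_EFinP; exact: measurable_exp_dens.
move=> x _ /=; rewrite lee_fin !ger0_norm ?exp_dens_ge0//.
have [Bx|Bx] := pselect (B x); first by rewrite !exp_densE//; exact: BB'.
by rewrite (exp_dens0 _ Bx) exp_dens_ge0.
Qed.

(** The exponential never vanishes, so a zero integral would make [B] negligible. *)
Lemma Rintegral_exp_dens_gt0 B theta : measurable B ->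
  dom_log_laplace mu B theta -> ~ mu.-negligible B ->
  0 < \int[mu]_x exp_dens B theta x.
Proof.
move=> mB domB nB; have intB := (dom_integrable theta mB).1 domB.
rewrite lt_neqAle Rintegral_ge0 ?andbT; last by move=> x _; exact: exp_dens_ge0.
apply/eqP => /esym Z0; apply: nB.
have absE : (\int[mu]_x `|(EFin \o exp_dens B theta) x| = 0)%E.
  rewrite -[RHS]/(0%:E) -Z0 /Rintegral fineK ?integrable_fin_num//.
  by apply: eq_integral => x _ /=; rewrite ger0_norm//; exact: exp_dens_ge0.
have mf : measurable_fun setT (EFin \o exp_dens B theta).
  by apply/measurable_EFinP; exact: measurable_exp_dens.
have := (ae_eq_integral_abs mu measurableT mf).1 absE.
apply: negligibleS => x /= Bx /(_ I) [] /eqP.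
by rewrite exp_densE// expR_eq0.
Qed.

Lemma normalizedZ (f : E -> R) (c : R) : mu.-integrable setT (EFin \o f) -> c != 0 ->
  forall A, measurable A -> normalized mu (fun x => c * f x) A = normalized mu f A.
Proof.
move=> intf c0 A mA; rewrite /normalized !RintegralZl//; last exact: integrableS intf.
by rewrite -mulf_div divff// mul1r.
Qed.

Lemma normalized_ae (f h : E -> R) A : measurable_fun setT f -> measurable_fun setT h ->
  {ae mu, forall x, f x = h x} -> measurable A ->
  normalized mu f A = normalized mu h A.
Proof.
move=> mf mh fh mA.
have intE B : measurable B -> \int[mu]_(x in B) f x = \int[mu]_(x in B) h x.
  move=> mB; congr fine; apply: ae_eq_integral => //.
  - exact/measurable_funTS/measurable_EFinP.
  - exact/measurable_funTS/measurable_EFinP.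
  - by apply: filterS fh => x fhx _; rewrite /= fhx.
by rewrite /normalized !intE.
Qed.

Lemma exp_law_nonnegligible B theta P : measurable B -> exp_law mu B theta P ->
  ~ mu.-negligible B.
Proof.
move=> mB PB /(negligibleP mu mB) B0; have := PB _ measurableT.
rewrite setTI probability_setT.
(* On a negligible [B] the logarithm of 0 makes the density constantly infinite, yet its integral
   over [B] is 0 instead of 1. *)
have -> : log_laplace mu B theta = -oo%E.
  rewrite /log_laplace null_set_integral ?le0_lneNy//.
  by apply: measurable_funTS; apply/measurable_EFinP; exact: measurable_expR_dot.
rewrite (eq_integral (cst +oo%E)) => [|x _]; last by [].
rewrite null_set_integral//.
by move=> /eqP; rewrite onee_eq0.
Qed.

Lemma exp_lawP B theta P : measurable B -> dom_log_laplace mu B theta ->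
  ~ mu.-negligible B ->
  exp_law mu B theta P <->
  forall A, measurable A -> P A = (normalized mu (exp_dens B theta) A)%:E.
Proof.
move=> mB domB nB; have intB := (dom_integrable theta mB).1 domB.
have Z0 := Rintegral_exp_dens_gt0 mB domB nB.
suff H A : measurable A ->
    (\int[mu]_(x in A `&` B) expeR ((dot theta x)%:E - log_laplace mu B theta))%E =
    (normalized mu (exp_dens B theta) A)%:E.
  by split=> PB A mA; rewrite PB// H.
move=> mA; have -> : log_laplace mu B theta = (ln (\int[mu]_x exp_dens B theta x))%:E.
  rewrite /log_laplace -[B in (\int[mu]_(_ in B) _)%E](setTI B) integral_exp_dens.
  by rewrite -lne_EFin// /Rintegral fineK// integrable_fin_num.
under eq_integral do rewrite -EFinB /= expRB lnK ?posrE// mulrC EFinM.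
have mAB : measurable (A `&` B) by exact: measurableI.
rewrite ge0_integralZl_EFin//=.
- rewrite integral_exp_dens /normalized mulrC EFinM /Rintegral fineK//.
  by apply: integrable_fin_num => //; exact: integrableS intB.
- by apply: measurable_funTS; apply/measurable_EFinP; exact: measurable_expR_dot.
- by rewrite invr_ge0 ltW.
Qed.

Lemma exp_law_exists B theta : measurable B -> dom_log_laplace mu B theta ->
  ~ mu.-negligible B -> exists P, exp_law mu B theta P.
Proof.
move=> mB domB nB; have intB := (dom_integrable theta mB).1 domB.
have Z0 := Rintegral_exp_dens_gt0 mB domB nB.
pose f x := (\int[mu]_x exp_dens B theta x)^-1 * exp_dens B theta x.
have intf A : measurable A ->
    (\int[mu]_(x in A) (f x)%:E)%E = (normalized mu (exp_dens B theta) A)%:E.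
  move=> mA; under eq_integral do rewrite EFinM.
  rewrite ge0_integralZl_EFin//=.
  - rewrite /normalized mulrC EFinM /Rintegral fineK//.
    by apply: integrable_fin_num => //; exact: integrableS intB.
  - by move=> x _; rewrite lee_fin exp_dens_ge0.
  - by apply: measurable_funTS; apply/measurable_EFinP; exact: measurable_exp_dens.
  - by rewrite invr_ge0 ltW.
have mf : measurable_fun setT f.
  by apply: measurable_funM => //; exact: measurable_exp_dens.
have f0 x : 0 <= f x by rewrite mulr_ge0 ?exp_dens_ge0// invr_ge0 ltW.
have f1 : (\int[mu]_x (f x)%:E = 1)%E.
  by rewrite intf// /normalized divff// gt_eqF.
have [P PE] := ex_probability_density mf f0 f1.
by exists P; apply/exp_lawP => // A mA; rewrite PE intf.
Qed.

(** Differences of points of cl(F) lie in [lin F], so [theta - theta'] is constant there. Hence a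
    law on cl(F) depends only on the projection of its parameter. *)
Lemma exp_dens_orth F theta theta' : F !=set0 ->
  (forall u, lin F u -> dot (theta - theta') u = 0) ->
  exists2 c : R, 0 < c &
    exp_dens (closure F) theta = (fun x => c * exp_dens (closure F) theta' x).
Proof.
move=> [a Fa] orth; exists (expR (dot (theta - theta') a)); first exact: expR_gt0.
apply/funext => x; have [Fx|Fx] := pselect (closure F x); last first.
  by rewrite !exp_dens0// mulr0.
rewrite !exp_densE// -expRD; congr expR.
have := orth _ (lin_closure Fa Fx); rewrite dotBr => /eqP; rewrite subr_eq0 => /eqP <-.
by rewrite dotBl subrK.
Qed.

Lemma dom_orth F theta theta' : F !=set0 ->
  (forall u, lin F u -> dot (theta - theta') u = 0) ->
  dom_log_laplace mu (closure F) theta' -> dom_log_laplace mu (closure F) theta.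
Proof.
move=> F0 orth; have mF := closure_measurable_rV F.
have [c c0 cE] := exp_dens_orth F0 orth.
move=> /(dom_integrable _ mF) i; apply/(dom_integrable _ mF); rewrite cE.
rewrite (_ : _ \o _ = (fun x => c%:E * (EFin \o exp_dens (closure F) theta') x)%E).
  exact: integrableZl.
by apply/funext => x /=; rewrite EFinM.
Qed.

Lemma normalized_orth F theta theta' : F !=set0 ->
  (forall u, lin F u -> dot (theta - theta') u = 0) ->
  dom_log_laplace mu (closure F) theta' ->
  forall A, measurable A ->
    normalized mu (exp_dens (closure F) theta) A =
    normalized mu (exp_dens (closure F) theta') A.
Proof.
move=> F0 orth; have mF := closure_measurable_rV F.
have [c c0 ->] := exp_dens_orth F0 orth.
by move=> /(dom_integrable _ mF) i A mA; rewrite normalizedZ// gt_eqF.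
Qed.

End exponential_density.

(** * Laws on accessible faces as limits *)

Section approximation.
Context {R : realType} {d : nat}.
Local Notation E := 'rV[R]_d.
Context (mu : {finite_measure set E -> \bar R}).
Implicit Types (B F G A Xi : set E) (theta tau x y : E).

Lemma ler_dist_half (a b c e : R) : `|a - b| <= e / 2 -> `|c - a| <= e / 2 ->
  `|c - b| <= e.
Proof.
by move=> ab ca; have := ler_normD (c - a) (a - b); rewrite addrA subrK; lra.
Qed.

Lemma expR_scale_cvg0 (a b : R) : b < 0 -> expR (a + n%:R * b) @[n --> \oo] --> (0 : R).
Proof.
move=> b0; rewrite -(mulr0 (expR a)).
under eq_fun do rewrite expRD expRM_natl.
apply: cvgM; [exact: cvg_cst|apply: cvg_expr].
by rewrite ger0_norm ?expR_ge0// -expR0 ltr_expR.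
Qed.

(** Since <tau, x> is at most k on cl(F), the densities scaled by e^(-nk) are dominated by the one
    at [theta]; they tend to 0 off the supporting hyperplane and are constant in n on it. *)
Lemma exposed_approx F tau G theta : F = core_on mu (closure F) ->
  exposes F tau G -> dom_log_laplace mu (closure F) theta ->
  forall e : R, 0 < e -> exists n : nat,
    dom_log_laplace mu (closure F) (theta + n%:R *: tau) /\
    forall A, measurable A ->
    `|normalized mu (exp_dens (closure F) (theta + n%:R *: tau)) A -
      normalized mu (exp_dens (closure G) theta) A| <= e.
Proof.
move=> coreF expo domF e e0.
have [F0 G0 _ _ _] := exposes_lin expo.
have [k [Fk GE]] := exposesE expo.
have coreG : G = core_on mu (closure G) by rewrite GE; exact: core_on_face.
have cGF : closure G `<=` closure F `&` [set x | dot tau x = k].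
  by rewrite GE; exact: closure_supporting.
have domG : dom_log_laplace mu (closure G) theta.
  by apply: dom_subset domF => // x /cGF[].
have intF := (dom_integrable mu theta (closure_measurable_rV F)).1 domF.
have nF := core_on_nonnegligible coreF F0.
have nG := core_on_nonnegligible coreG G0.
pose f_ (n : nat) x := expR (- (n%:R * k)) * exp_dens (closure F) (theta + n%:R *: tau) x.
have f_E n x : closure F x -> f_ n x = expR (dot theta x + n%:R * (dot tau x - k)).
  by move=> Fx; rewrite /f_ exp_densE// -expRD dotDl dotZl; congr expR; ring.
have f_0 n x : ~ closure F x -> f_ n x = 0.
  by move=> Fx; rewrite /f_ exp_dens0// mulr0.
have f_le n x : 0 <= f_ n x <= exp_dens (closure F) theta x.
  have [Fx|Fx] := pselect (closure F x); last by rewrite f_0// lexx exp_dens_ge0.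
  rewrite f_E// expR_ge0 exp_densE//= ler_expR gerDl mulr_ge0_le0//.
  by rewrite subr_le0 (closure_dot_le Fk).
have mf_ n : measurable_fun setT (f_ n).
  by apply: measurable_funM => //; exact: measurable_exp_dens.
have intf_ n : mu.-integrable setT (EFin \o f_ n).
  apply: le_integrable intF => //; first exact/measurable_EFinP.
  move=> x _; have /andP[? ?] := f_le n x.
  by rewrite lee_fin !ger0_norm ?exp_dens_ge0.
have domn n : dom_log_laplace mu (closure F) (theta + n%:R *: tau).
  apply/(dom_integrable _ _ (closure_measurable_rV F)).
  rewrite (_ : _ \o _ = (fun x => (expR (n%:R * k))%:E * (EFin \o f_ n) x)%E).
    exact: integrableZl.
  apply/funext => x /=; rewrite -EFinM /f_ mulrA -expRD addrN expR0 mul1r.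
  by [].
have intn n := (dom_integrable mu _ (closure_measurable_rV F)).1 (domn n).
have Zn0 n := Rintegral_exp_dens_gt0 (closure_measurable_rV F) (domn n) nF.
have [n en] : exists n, forall A, measurable A ->
    `|normalized mu (f_ n) A - normalized mu (exp_dens (closure G) theta) A| <= e.
  apply: (normalized_cvg mf_ _ f_le intF) => //.
  - exact: measurable_exp_dens.
  (* The limit can differ from the density on cl(G) only on the hyperplane part of cl(F) outside
     cl(G), which is negligible. *)
  - have := negligible_supporting coreF Fk; rewrite -GE.
    apply: negligibleS => x nx; apply: contrapT => Gx; apply: nx => /=.
    have [Fx|Fx] := pselect (closure F x); last first.
      rewrite exp_dens0; last by move=> /cGF[].
      by under eq_fun do rewrite f_0//; exact: cvg_cst.
    have [xk|xk] := eqVneq (dot tau x) k.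
      have cGx : closure G x by apply: contrapT => nGx; apply: Gx.
      rewrite exp_densE//; under eq_fun do rewrite f_E// xk subrr mulr0 addr0.
      exact: cvg_cst.
    rewrite exp_dens0; last by move=> /cGF[_ /= xk']; rewrite xk' eqxx in xk.
    under eq_fun do rewrite f_E//.
    apply: expR_scale_cvg0; rewrite subr_lt0 lt_neqAle xk.
    by rewrite (closure_dot_le Fk).
  - move=> n; rewrite /f_ (RintegralZl _ measurableT (intn n)).
    by apply: mulr_gt0 (Zn0 n); exact: expR_gt0.
  - exact: Rintegral_exp_dens_gt0.
exists n; split; first exact: domn.
have c0 : expR (- (n%:R * k)) != 0 by rewrite gt_eqF// expR_gt0.
by move=> A mA; rewrite -(normalizedZ (intn n) c0 mA); exact: en.
Qed.

Lemma ri_pi F Xi : F !=set0 -> convex_set Xi ->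
  [set pi_ F x | x in ri Xi] = ri [set pi_ F x | x in Xi].
Proof.
move=> /pi_mx[P piE] cXi.
rewrite (_ : pi_ F = fun x => x *m P); last exact/funext.
exact: ri_image.
Qed.

Lemma pi_orthl F theta u : F !=set0 -> lin F u -> dot (pi_ F theta - theta) u = 0.
Proof. by move=> F0 Lu; rewrite dotBl dot_pi// subrr. Qed.

(** Induction along the chain: a law on [F_ i.+1] is near one on [F_ i] with parameter moved along
    the exposing direction, and half of the error is kept for each of the two approximations. *)
Lemma chain_approx Xi F (taus : seq E) (F_ : nat -> set E) :
  (forall theta, Xi theta -> dom_log_laplace mu setT theta) ->
  access_chain (cc mu) F taus F_ ->
  (forall i, (i < size taus)%N -> recession_cone [set pi_ (F_ i) x | x in ri Xi] taus`_i) ->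
  forall i, (i <= size taus)%N -> forall theta, ri Xi theta ->
  forall e : R, 0 < e -> exists2 theta', Xi theta' & forall A, measurable A ->
    `|normalized mu (exp_dens setT theta') A -
      normalized mu (exp_dens (closure (F_ i)) theta) A| <= e.
Proof.
move=> domXi chain adapt; have coreF := access_chain_core chain.
have domF G theta : ri Xi theta -> dom_log_laplace mu (closure G) theta.
  by move=> /ri_sub/domXi; apply: dom_subset.
have [F0 _ expo] := chain; elim=> [_|i IH isize] theta riXi e e0.
  exists theta; first exact: ri_sub.
  (* The closure of the convex core carries all the mass, so both laws coincide. *)
  move=> A mA; rewrite F0 (@normalized_ae _ _ mu _ (exp_dens (closure (cc mu)) theta))//.
  - by rewrite subrr normr0 ltW.
  - exact: measurable_exp_dens.
  - exact: measurable_exp_dens.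
  - have := negligible_core_on mu setT; rewrite -cc_core_on.
    apply: negligibleS => x xcc; split => // ccx; apply: xcc.
    by move=> /=; rewrite !exp_densE.
have [Fi0 _ _ Ltau _] := exposes_lin (expo _ isize).
have e2 : 0 < e / 2 by lra.
have [n [domn nE]] := exposed_approx (coreF _ (ltnW isize)) (expo _ isize) (domF _ _ riXi) e2.
(* The moved parameter may leave [Xi]; adaptedness supplies a point of [ri Xi] with the same
   projection, hence the same law on cl(F_i). *)
have [theta1 riXi1 pi1] : [set pi_ (F_ i) x | x in ri Xi] (pi_ (F_ i) theta + n%:R *: taus`_i).
  by apply: adapt => //; exists theta.
have [theta' Xi' theta'E] := IH (ltnW isize) _ riXi1 _ e2.
exists theta' => // A mA.
have orth u : lin (F_ i) u -> dot (theta1 - (theta + n%:R *: taus`_i)) u = 0.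
  move=> Lu; rewrite dotBl -(dot_pi theta1 Fi0 Lu) -(dot_pi (theta + _) Fi0 Lu) pi1 piD//.
  by rewrite (pi_id Fi0 (linZ _ Fi0 Ltau)) subrr.
have := theta'E _ mA; rewrite (normalized_orth Fi0 orth domn mA).
have := nE _ mA.
exact: ler_dist_half.
Qed.

Lemma segment_approx B theta theta0 : measurable B -> ~ mu.-negligible B ->
  dom_log_laplace mu B theta -> dom_log_laplace mu B theta0 ->
  forall e : R, 0 < e -> exists n : nat,
    let theta' := n.+1%:R^-1 *: theta0 + (1 - n.+1%:R^-1) *: theta in
    dom_log_laplace mu B theta' /\ forall A, measurable A ->
    `|normalized mu (exp_dens B theta') A -
      normalized mu (exp_dens B theta) A| <= e.
Proof.
move=> mB nB dom1 dom0 e e0.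
have int1 := (dom_integrable mu theta mB).1 dom1.
have int0 := (dom_integrable mu theta0 mB).1 dom0.
pose th (n : nat) := n.+1%:R^-1 *: theta0 + (1 - n.+1%:R^-1) *: theta.
pose g x := exp_dens B theta x + exp_dens B theta0 x.
have intg : mu.-integrable setT (EFin \o g).
  by rewrite (_ : _ \o g =
    (EFin \o exp_dens B theta) \+ (EFin \o exp_dens B theta0))%E//; exact: integrableD.
have f_le n x : 0 <= exp_dens B (th n) x <= g x.
  rewrite exp_dens_ge0/= /g.
  have [Bx|Bx] := pselect (B x); last by rewrite !exp_dens0// addr0.
  rewrite !exp_densE// dotDl !dotZl.
  have t0 : 0 <= n.+1%:R^-1 :> R by rewrite invr_ge0.
  have t1 : n.+1%:R^-1 <= 1 :> R by rewrite invf_le1 ?ltr0n// ler1n.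
  move: t0 t1; move: (n.+1%:R^-1) => t t0 t1.
  (* The exponent is at most the larger of those at the endpoints. *)
  have [ab|ab] := leP (dot theta x) (dot theta0 x).
    apply: le_trans (_ : expR (dot theta0 x) <= _); last by rewrite lerDr expR_ge0.
    by rewrite ler_expR; nra.
  apply: le_trans (_ : expR (dot theta x) <= _); last by rewrite lerDl expR_ge0.
  by rewrite ler_expR; nra.
have mf_ n : measurable_fun setT (exp_dens B (th n)) by exact: measurable_exp_dens.
have domn n : dom_log_laplace mu B (th n).
  apply/(dom_integrable _ _ mB); apply: le_integrable intg => //.
    exact/measurable_EFinP.
  move=> x _; have /andP[? ?] := f_le n x.
  by rewrite lee_fin !ger0_norm ?addr_ge0 ?exp_dens_ge0.
have [n en] : exists n, forall A, measurable A ->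
    `|normalized mu (exp_dens B (th n)) A - normalized mu (exp_dens B theta) A| <= e.
  apply: (normalized_cvg mf_ _ f_le intg) => //.
  - exact: measurable_exp_dens.
  - apply: aeW => x; have [Bx|Bx] := pselect (B x); last first.
      by rewrite exp_dens0//; under eq_fun do rewrite exp_dens0//; exact: cvg_cst.
    rewrite exp_densE//; under eq_fun do rewrite exp_densE//.
    suff h : dot (th n) x @[n --> \oo] --> dot theta x.
      by apply: continuous_cvg h; exact: continuous_expR.
    rewrite /th; under eq_fun do rewrite dotDl !dotZl.
    suff : n.+1%:R^-1 * dot theta0 x + (1 - n.+1%:R^-1) * dot theta x @[n --> \oo] -->
        0 * dot theta0 x + (1 - 0) * dot theta x.
      by rewrite mul0r add0r subr0 mul1r.
    apply: cvgD; apply: cvgM; try exact: cvg_cst; first exact: cvg_harmonic.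
    by apply: cvgB; [exact: cvg_cst|exact: cvg_harmonic].
  - by move=> n; exact: Rintegral_exp_dens_gt0 mB (domn n) nB.
  - exact: Rintegral_exp_dens_gt0 mB dom1 nB.
exists n; split; [exact: domn|exact: en].
Qed.

Lemma exp_family_face_sub_cl_v Xi F :
  (forall theta, Xi theta -> dom_log_laplace mu setT theta) ->
  Xi !=set0 -> convex_set Xi -> accessible_face Xi (cc mu) F ->
  exp_family_face mu F Xi `<=` cl_v (exp_family mu Xi).
Proof.
move=> domXi Xi0 cXi [[F0 _ _ _] [taus [F_ chain adapt]]] P [theta [clth [domth Lth]] PE].
have nF := exp_law_nonnegligible (closure_measurable_rV F) PE.
have {}PE := (exp_lawP P (closure_measurable_rV F) domth nF).1 PE.
have nT : ~ mu.-negligible setT by move=> nT; apply: nF; exact: negligibleS nT.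
apply/cl_vP => e e0; have e2 : 0 < e / 2 by lra.
have [theta0 ri0] := ri_nonempty cXi Xi0.
have dom0 : dom_log_laplace mu (closure F) theta0.
  by apply: dom_subset (domXi _ (ri_sub ri0)).
have dompi0 : dom_log_laplace mu (closure F) (pi_ F theta0).
  by apply: dom_orth dom0 => // u Lu; exact: pi_orthl.
have [n [domn nE]] := segment_approx (closure_measurable_rV F) nF domth dompi0 e2.
(* [theta] is only in the closure of the projection; moving slightly towards a relative interior
   point makes the parameter liftable to [ri Xi], where [chain_approx] applies. *)
have : ri [set pi_ F x | x in Xi] (n.+1%:R^-1 *: pi_ F theta0 + (1 - n.+1%:R^-1) *: theta).
  apply: ri_segment => //.
  - have [Q QE] := pi_mx F0; rewrite (_ : pi_ F = fun x => x *m Q); last exact/funext.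
    exact: convex_image.
  - by rewrite -ri_pi//; exists theta0.
  - by rewrite invr_gt0 ltr0n/= invf_le1 ?ltr0n// ler1n.
rewrite -ri_pi// => -[theta1 ri1 pi1].
have [_ Fsize _] := chain.
have [theta' Xi' theta'E] := chain_approx domXi chain adapt (leqnn _) ri1 e2.
have [Q QE] := exp_law_exists measurableT (domXi _ Xi') nT.
exists Q; first by exists theta'.
have {}QE := (exp_lawP Q measurableT (domXi _ Xi') nT).1 QE.
move=> A mA; rewrite PE// QE// -EFinB lee_fin.
have := theta'E _ mA; have := nE _ mA; rewrite Fsize -pi1.
have dom1 : dom_log_laplace mu (closure F) theta1.
  by apply: dom_subset (domXi _ (ri_sub ri1)).
rewrite (normalized_orth F0 (fun u => pi_orthl theta1 F0) dom1 mA).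
by rewrite [X in _ -> _ -> X <= _]distrC; exact: ler_dist_half.
Qed.

End approximation.

(** * Limits as laws on accessible faces *)

Section L1_ae.
Context {disp : measure_display} {T : measurableType disp} {R : realType}.
Context (mu : {measure set T -> \bar R}).

(** The series of the [h n] has integral at most 1, so it is finite almost everywhere and its terms
    tend to 0. *)
Lemma summable_L1_cvg_ae (h : nat -> T -> R) :
  (forall n, measurable_fun setT (h n)) -> (forall n x, 0 <= h n x) ->
  (forall n, (\int[mu]_x (h n x)%:E <= (1 / (2 ^ n.+1)%:R)%:E)%E) ->
  {ae mu, forall x, h ^~ x @ \oo --> (0 : R)}.
Proof.
move=> mh h0 hle; pose g x := (\sum_(n <oo) (h n x)%:E)%E.
have h0' n x : setT x -> (0 <= (h n x)%:E)%E by rewrite lee_fin.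
have mh' n : measurable_fun setT (EFin \o h n) by exact/measurable_EFinP.
have g0 x : (0 <= g x)%E by apply: nneseries_ge0 => n _ _; rewrite lee_fin.
have ig : mu.-integrable setT g.
  apply/integrableP; split.
    by apply: ge0_emeasurable_sum => [n x Dx _|n _]; [exact: h0'|exact: mh'].
  under eq_integral do rewrite gee0_abs//.
  rewrite /g integral_nneseries//.
  apply: le_lt_trans (_ : _ <= 1%:E)%E (ltry _).
  apply: le_trans (epsilon_trick0 xpredT (@ler01 R)).
  apply: lee_nneseries => n *; first by apply: integral_ge0 => x _; exact: h0'.
  exact: hle.
apply: filterS (integrable_ae measurableT ig) => x /(_ I) gx.
apply: cvg_series_cvg_0; apply: nondecreasing_is_cvgn.
  by apply/nondecreasing_seqP => n; rewrite /series/= big_nat_recr//= lerDl.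
exists (fine (g x)) => _ [n _ <-]; rewrite -lee_fin fineK// /series/= -sumEFin.
by apply: nneseries_lim_ge => k _; rewrite lee_fin.
Qed.

Lemma dist_densities (f p : T -> R) (e : R) :
  mu.-integrable setT (EFin \o f) -> mu.-integrable setT (EFin \o p) ->
  (forall A, measurable A ->
    `|\int[mu]_(x in A) p x - \int[mu]_(x in A) f x| <= e) ->
  (\int[mu]_x `|f x - p x|%:E <= (e + e)%:E)%E.
Proof.
move=> intf intp fpe.
have mf : measurable_fun setT f by apply/measurable_EFinP; exact: measurable_int intf.
have mp : measurable_fun setT p by apply/measurable_EFinP; exact: measurable_int intp.
have intd : mu.-integrable setT (EFin \o (fun x => f x - p x)).
  by rewrite (_ : _ \o _ = (EFin \o f) \- (EFin \o p))%E//; exact: integrableB.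
have inta : mu.-integrable setT (EFin \o (fun x => `|f x - p x|)).
  exact: integrable_norm intd.
(* The difference has constant sign on [D] and on its complement, so the hypothesis on events bounds
   each half. *)
pose D := [set x | p x <= f x].
have mD : measurable D by rewrite -[D]setTI; exact: measurable_fun_le.
have intS g B : mu.-integrable setT (EFin \o g) -> measurable B -> mu.-integrable B (EFin \o g).
  by move=> ig mB; exact: integrableS ig.
have -> : (\int[mu]_x `|f x - p x|%:E)%E = (\int[mu]_x `|f x - p x|)%:E.
  by rewrite /Rintegral fineK//; exact: integrable_fin_num inta.
rewrite lee_fin -(setUv D) Rintegral_setU//; [|exact: measurableC|by rewrite setUv|]; last first.
  by apply/disj_setPS => x [].
apply: lerD.
  rewrite (@eq_Rintegral _ _ _ _ D (fun x => f x - p x)); last first.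
    by move=> x; rewrite inE => Dx; rewrite ger0_norm// subr_ge0.
  rewrite RintegralB//; try exact: intS.
  by apply: le_trans (fpe _ mD); rewrite distrC ler_norm.
rewrite (@eq_Rintegral _ _ _ _ (~` D) (fun x => p x - f x)); last first.
  move=> x; rewrite inE => /negP; rewrite -ltNge => Dx.
  by rewrite distrC ger0_norm// subr_ge0 ltW.
have mDC := measurableC mD.
rewrite RintegralB//; try exact: intS.
by apply: le_trans (fpe _ mDC); rewrite ler_norm.
Qed.

End L1_ae.

Section limit_density.
Context {R : realType} {d : nat}.
Local Notation E := 'rV[R]_d.
Context (mu : {finite_measure set E -> \bar R}).

Lemma cl_v_density (Xi : set E) (P : probability E R) :
  (forall theta, Xi theta -> dom_log_laplace mu setT theta) ->
  mu setT <> 0%E -> cl_v (exp_family mu Xi) P ->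
  exists (theta : nat -> E) (c : nat -> R) (p : E -> R),
    [/\ forall n, Xi (theta n), forall n, 0 < c n,
        mu.-integrable setT (EFin \o p),
        forall A, measurable A -> P A = (\int[mu]_(x in A) p x)%:E &
        {ae mu, forall x, (fun n => c n * expR (dot (theta n) x)) @ \oo --> p x}].
Proof.
move=> domXi mu0 /cl_vP clP.
have nT : ~ mu.-negligible setT by move/(negligibleP _ measurableT).
(* Passing from events to densities doubles the error, leaving the summable bound 1 / 2^(n+1). *)
have e0 n : 0 < ((2 ^ n.+1)%:R)^-1 / 2 :> R by rewrite divr_gt0 ?invr_gt0 ?ltr0n ?expn_gt0.
have /choice[theta thetaP] : forall n, exists theta, Xi theta /\ forall A, measurable A ->
    (`|P A - (normalized mu (exp_dens setT theta) A)%:E| <= (((2 ^ n.+1)%:R)^-1 / 2)%:E)%E.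
  move=> n; have [Q [theta Xit Qt] PQ] := clP _ (e0 n).
  exists theta; split=> // A mA.
  by rewrite -((exp_lawP _ measurableT (domXi _ Xit) nT).1 Qt _ mA); exact: PQ.
have Xit n := (thetaP n).1; have Pt n := (thetaP n).2.
have int n := (dom_integrable mu (theta n) measurableT).1 (domXi _ (Xit n)).
have Z0 n := Rintegral_exp_dens_gt0 measurableT (domXi _ (Xit n)) nT.
pose c n := (\int[mu]_x exp_dens setT (theta n) x)^-1.
have c0 n : 0 < c n by rewrite invr_gt0.
pose f n x := c n * exp_dens setT (theta n) x.
have intf n : mu.-integrable setT (EFin \o f n).
  rewrite (_ : _ \o _ = (fun x => (c n)%:E * (EFin \o exp_dens setT (theta n)) x)%E).
    exact: integrableZl.
  by apply/funext => x /=; rewrite EFinM.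
have fE n A : measurable A ->
    \int[mu]_(x in A) f n x = normalized mu (exp_dens setT (theta n)) A.
  by move=> mA; rewrite RintegralZl//; [rewrite /normalized mulrC|exact: integrableS (int n)].
have PA A : measurable A -> P A = (fine (P A))%:E.
  by move=> mA; rewrite fineK// fin_num_measure.
have Pf n A : measurable A -> `|fine (P A) - \int[mu]_(x in A) f n x| <= ((2 ^ n.+1)%:R)^-1 / 2.
  by move=> mA; rewrite fE// -lee_fin; have := Pt n A mA; rewrite {1}PA.
(* On a null event the approximating laws vanish, so [P] is below every error bound. This provides a
   Radon-Nikodym density. *)
have Pmu : charge_of_finite_measure P `<< mu.
  apply/null_content_dominatesP => A mA muA0 /=.
  rewrite /charge_of_finite_measure PA//; congr EFin.
  have PA0 n : `|fine (P A)| <= ((2 ^ n.+1)%:R)^-1 / 2.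
    have := Pf n A mA; rewrite (_ : \int[mu]_(x in A) f n x = 0) ?subr0//.
    rewrite /Rintegral null_set_integral//; apply: measurable_funTS.
    exact: measurable_int (intf n).
  apply/eqP; rewrite -normr_eq0 eq_le normr_ge0 andbT.
  apply/ler_addgt0Pl => e e_gt0; rewrite addr0.
  have [n ne] := ltr_add_invr e_gt0; apply: le_trans (PA0 n) _.
  rewrite add0r in ne; apply: le_trans (ltW ne).
  apply: (@le_trans _ _ ((2 ^ n.+1)%:R)^-1).
    by rewrite ler_pdivrMr// ler_peMr ?invr_ge0// ler1n.
  by rewrite lef_pV2 ?posrE ?ltr0n ?expn_gt0// ler_nat ltnW// ltn_expl.
pose p := fine \o Radon_Nikodym (charge_of_finite_measure P) mu.
have pE : EFin \o p = Radon_Nikodym (charge_of_finite_measure P) mu.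
  by apply/funext => x; rewrite /= fineK//; exact: Radon_Nikodym_fin_num.
have intp : mu.-integrable setT (EFin \o p).
  by rewrite pE; exact: Radon_Nikodym_integrable.
have Pp A : measurable A -> P A = (\int[mu]_(x in A) p x)%:E.
  move=> mA; rewrite -[LHS]/(charge_of_finite_measure P A) (Radon_Nikodym_integral Pmu mA) -pE.
  by rewrite /Rintegral fineK//; apply: integrable_fin_num => //; exact: integrableS intp.
exists theta, c, p; split => //.
have : {ae mu, forall x, (fun n => `|f n x - p x|) @ \oo --> (0 : R)}.
  have mp : measurable_fun setT p by apply/measurable_EFinP; exact: measurable_int intp.
  have mf n : measurable_fun setT (f n) by apply/measurable_EFinP; exact: measurable_int (intf n).
  apply: summable_L1_cvg_ae => // n.
    by apply: measurableT_comp => //; exact: measurable_funB.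
  apply: le_trans (dist_densities (intf n) intp _) _.
    move=> A mA; have := Pf n A mA; rewrite Pp//=; exact.
  by rewrite lee_fin -splitr div1r.
apply: filterS => x fp; have -> : (fun n => c n * expR (dot (theta n) x)) = f ^~ x.
  by apply/funext => n; rewrite /f exp_densE.
apply/cvgrPdist_lt => e e_gt0; move/cvgrPdist_lt : fp => /(_ _ e_gt0).
by apply: filterS => n; rewrite sub0r normrN normr_id distrC.
Qed.

End limit_density.

(** A cluster point of an ultrafilter is a limit. One ultrafilter thus serves the whole descent,
    with no further extraction of subsequences. *)
Lemma ultra_compact_cvg {I : Type} {T : topologicalType} (U : set_system I)
    (f : I -> T) (K : set T) : UltraFilter U -> compact K ->
  (\forall i \near U, K (f i)) -> exists2 x, K x & f @ U --> x.
Proof.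
move=> UU cK Kf; have [x [Kx clx]] := cK (f @ U) _ Kf; exists x => // W Wx.
have [//|nW] := in_ultra_setVsetC (f @^-1` W) UU.
have [y [nWy Wy]] := clx (~` W) W nW Wx.
by case: nWy.
Qed.

(** * Limits along an ultrafilter *)

Section asymptotics.
Context {R : realType} {d : nat}.
Local Notation E := 'rV[R]_d.
Context (U : set_system nat) (UU : UltraFilter U).
Implicit Types (A F : set E) (eta : nat -> E) (tau x y : E).

Lemma compact_norm_le (M : R) : compact [set x : E | `|x| <= M].
Proof.
apply: bounded_closed_compact.
  exists M; split; first exact: num_real.
  by move=> r Mr x /= /le_trans; apply; exact: ltW.
rewrite (_ : mkset _ = (fun x : E => `|x|) @^-1` [set r : R | r <= M])//.
apply: closed_comp; last exact: closed_le.
by move=> x _; exact: norm_continuous.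
Qed.

Lemma closure_cvg A eta x : (forall n, A (eta n)) -> eta @ U --> x -> closure A x.
Proof.
move=> Aeta etax W Wx.
have /filter_ex[n Wn] : \forall n \near U, W (eta n) by exact: etax.
by exists (eta n).
Qed.

(* If s_n / l_n has a positive limit then s_n tends to +oo, so the ratio of the
   densities at the two points would be unbounded. *)
Lemma density_ratio_le0 (u v s l : nat -> R) (a b delta : R) :
  (forall n, v n = u n * expR (s n)) -> (forall n, 0 <= u n) ->
  u @ U --> a -> v @ U --> b -> 0 < a ->
  (forall M : R, \forall n \near U, M < l n) ->
  (fun n => (l n)^-1 * s n) @ U --> delta -> delta <= 0.
Proof.
move=> vE u0 ua vb a0 loo sd; rewrite leNgt; apply/negP => delta0.
(* With u_n > a/2 and s_n > K, the value v_n exceeds (a/2) K = |b| + 1, against its limit b. *)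
pose K : R := 2 * (`|b| + 1) / a.
have K0 : 0 < K by rewrite divr_gt0// mulr_gt0// ltr_wpDl.
have d20 : 0 < delta / 2 by rewrite divr_gt0.
have a20 : 0 < a / 2 by rewrite divr_gt0.
have E1 : \forall n \near U, a / 2 < u n by apply: (cvgr_gt a) => //; lra.
have E2 : \forall n \near U, v n < `|b| + 1.
  by apply: (cvgr_lt b) => //; rewrite (le_lt_trans (ler_norm b))// ltrDl.
have E3 : \forall n \near U, delta / 2 < (l n)^-1 * s n.
  by apply: (cvgr_gt delta) => //; lra.
have [n [u2 v2 s2 l2]] : exists n, [/\ a / 2 < u n, v n < `|b| + 1,
    delta / 2 < (l n)^-1 * s n & K / (delta / 2) < l n].
  have [n [[[? ?] ?] ?]] :=
    filter_ex (filterI (filterI (filterI E1 E2) E3) (loo (K / (delta / 2)))).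
  by exists n.
have l0 : 0 < l n by rewrite (lt_trans _ l2)// divr_gt0.
have sK : K < s n.
  move: l2; rewrite ltr_pdivrMr// => /lt_trans; apply.
  by move: s2; rewrite ltr_pdivlMl.
have : a / 2 * K < v n.
  rewrite vE; apply: (lt_le_trans (_ : _ < a / 2 * expR (s n))).
    by rewrite ltr_pM2l//; apply: lt_trans sK _; have := expR_ge1Dx (s n); lra.
  by rewrite ler_wpM2r ?expR_ge0// ltW.
have -> : a / 2 * K = `|b| + 1 by rewrite /K; field; rewrite gt_eqF.
by move=> /lt_trans/(_ v2); rewrite ltxx.
Qed.

(** The point x + s tau is a limit of convex combinations of [x] and [eta n] with weight s / l_n on
    the latter, so the ray from [x] stays in the closure of [A]. *)
Lemma recession_ri A eta tau (l : nat -> R) : convex_set A ->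
  (forall n, A (eta n)) -> (forall M : R, \forall n \near U, M < l n) ->
  (fun n => (l n)^-1 *: eta n) @ U --> tau -> recession_cone (ri A) tau.
Proof.
move=> cA Aeta loo etatau x t riAx t0; have Ax := ri_sub riAx.
have linv0 : (fun n => (l n)^-1) @ U --> (0 : R).
  apply/cvgrPdist_lt => e e0; apply: filterS (loo e^-1) => n le.
  have l0 : 0 < l n by rewrite (lt_trans _ le)// invr_gt0.
  by rewrite sub0r normrN gtr0_norm ?invr_gt0// invf_plt ?posrE.
have clA s : 0 <= s -> closure A (x + s *: tau).
  move=> s0; have cvgs : (fun n => (1 - s * (l n)^-1) *: x + s *: ((l n)^-1 *: eta n)) @ U -->
      (1 - s * 0) *: x + s *: tau.
    apply: cvgD; last by apply: cvgZ => //; exact: cvg_cst.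
    apply: cvgZ; last exact: cvg_cst.
    by apply: cvgB; [exact: cvg_cst|apply: cvgM => //; exact: cvg_cst].
  rewrite -[x in x + _]scale1r -{1}(subr0 1) -{1}(mulr0 s) => W Wx.
  have /filter_ex[n [Wn ln]] : \forall n \near U,
      W ((1 - s * (l n)^-1) *: x + s *: ((l n)^-1 *: eta n)) /\ Num.max 0 s < l n.
    by apply: filterI; [exact: cvgs|exact: loo].
  exists ((1 - s * (l n)^-1) *: x + s *: ((l n)^-1 *: eta n)); split => //.
  move: ln; rewrite gt_max => /andP[l0 sl].
  have q0 : 0 <= s * (l n)^-1 by rewrite mulr_ge0// invr_ge0 ltW.
  have q1 : s * (l n)^-1 <= 1 by rewrite ler_pdivrMr// mul1r ltW.
  have := (convex_setP A).1 cA x (eta n) (1 - s * (l n)^-1) Ax (Aeta n).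
  by rewrite subKr scalerA; apply; rewrite subr_ge0 q1 gerBl.
(* As the midpoint of [x] and a closure point twice as far, x + t tau is in the relative
   interior. *)
have := @ri_segment _ _ A x (x + (t *+ 2) *: tau) (2^-1) cA riAx (clA _ _).
rewrite (_ : 2^-1 *: x + (1 - 2^-1) *: (x + t *+ 2 *: tau) = x + t *: tau); last first.
  by apply/rowP => i; rewrite !mxE; field.
by apply; [rewrite mulrn_wge0|rewrite invr_gt0 ltr0n invf_le1 ?ltr0n// ler1n].
Qed.

End asymptotics.

(** * Descent through exposed faces *)

Section descent.
Context {R : realType} {d : nat}.
Local Notation E := 'rV[R]_d.
Context (mu : {finite_measure set E -> \bar R}) (Xi : set E) (P : probability E R).
Context (U : set_system nat) (theta : nat -> E) (c : nat -> R) (p : E -> R).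
Context (UU : UltraFilter U) (cXi : convex_set Xi) (Xi_theta : forall n, Xi (theta n)).
Context (c_gt0 : forall n, 0 < c n) (intp : mu.-integrable setT (EFin \o p)).
Context (Pp : forall A, measurable A -> P A = (\int[mu]_(x in A) p x)%:E).

Let f n x : R := c n * expR (dot (theta n) x).

(** Densities are compared only at such points, which are almost all points. *)
Let good x := f ^~ x @ U --> p x.

Context (ae_good : {ae mu, forall x, good x}).

Let mp : measurable_fun setT p.
Proof. by apply/measurable_EFinP; exact: measurable_int intp. Qed.

Let f_ge0 n x : 0 <= f n x.
Proof. by rewrite mulr_ge0 ?expR_ge0// ltW. Qed.

Let good_ge0 x : good x -> 0 <= p x.
Proof.
move=> gx; apply: (cvgr_to_ge gx).
by apply: nearW => n; exact: f_ge0.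
Qed.

(** Otherwise [p] would vanish almost everywhere, against total mass 1. The point found serves as
    reference for comparing densities. *)
Lemma supported_gt0 (B : set E) : {ae mu, forall x, ~ B x -> p x = 0} ->
  exists x, [/\ B x, good x & 0 < p x].
Proof.
move=> suppB; apply: contrapT => nx.
have p0 : {ae mu, forall x, p x = 0}.
  apply: filterS2 suppB ae_good => x xB gx; have [Bx|/xB//] := pselect (B x).
  apply/eqP; rewrite eq_le good_ge0// andbT leNgt; apply/negP => px.
  by apply: nx; exists x.
have := Pp measurableT; rewrite probability_setT.
have -> : \int[mu]_x p x = \int[mu]_(x in [set: E]) (cst 0 : E -> R) x.
  congr fine; apply: ae_eq_integral => //.
    exact/measurable_EFinP.
    by apply/measurable_EFinP; exact: measurable_cst.
  by apply: filterS p0 => x /= ->.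
by rewrite Rintegral_cst// mul0r => /eqP; rewrite onee_eq0.
Qed.

Section face.
Context (F : set E) (F0 : F !=set0) (coreF : F = core_on mu (closure F)).
Context (suppF : {ae mu, forall x, ~ closure F x -> p x = 0}).

Let eta n := pi_ F (theta n).

(** Relating two points of cl(F) eliminates the normalizing constant and leaves only the projected
    parameter. *)
Lemma density_shift a x n : closure F a -> closure F x ->
  f n x = f n a * expR (dot (eta n) (x - a)).
Proof.
move=> Fa Fx; have [b Fb] := F0; rewrite /f -mulrA -expRD dot_pi//.
  by rewrite dotBr addrC subrK.
rewrite (_ : x - a = (x - b) - (a - b)); last by rewrite opprB addrA subrK.
by apply: linB => //; exact: lin_closure.
Qed.

(** Let n grow in [density_shift] with reference point [a]: on cl(F), [p] is almost everywhere a
    constant times the exponential at the limit parameter. *)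
Lemma bounded_limit (M : R) : (\forall n \near U, `|eta n| <= M) ->
  exp_family_face mu F Xi P.
Proof.
move=> etaM.
have cK := @compact_norm_le R d M.
have [th _ etath] := ultra_compact_cvg UU cK etaM.
have clth : closure [set pi_ F x | x in Xi] th.
  by apply: closure_cvg etath => n; exists (theta n).
have Lth : lin F th.
  have := closed_lin F0 => /closure_id ->.
  by apply: closure_cvg etath => n; exact: pi_lin.
have [a [Fa ga pa]] := supported_gt0 suppF.
pose k := p a * expR (- dot th a).
have k0 : 0 < k by rewrite mulr_gt0// expR_gt0.
have pE : {ae mu, forall x, p x = k * exp_dens (closure F) th x}.
  apply: filterS2 suppF ae_good => x sx gx.
  have [Fx|Fx] := pselect (closure F x); last by rewrite exp_dens0// mulr0 sx.
  rewrite exp_densE// /k -mulrA -expRD addrC -dotBr.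
  have h : f ^~ x @ U --> p a * expR (dot th (x - a)).
    rewrite (_ : f ^~ x = (fun n => f n a * expR (dot (eta n) (x - a)))); last first.
      by apply/funext => n; exact: density_shift.
    apply: cvgM => //; apply: continuous_cvg; first exact: continuous_expR.
    under eq_fun do rewrite dotC; rewrite dotC.
    by apply: continuous_cvg etath; exact: continuous_dot.
  by rewrite -(cvg_lim (@Rhausdorff R) h) -(cvg_lim (@Rhausdorff R) gx).
have mdens := measurable_exp_dens th (closure_measurable_rV F).
(* Finiteness at the limit parameter is inherited from integrability of [p]. *)
have domF : dom_log_laplace mu (closure F) th.
  apply/(dom_integrable _ _ (closure_measurable_rV F)).
  have ikp : mu.-integrable setT (fun x => (k^-1)%:E * (EFin \o p) x)%E.
    exact: integrableZl.
  apply/integrableP; split; first exact/measurable_EFinP.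
  move/integrableP : ikp => [mkp]; congr (_ < _)%E; apply: ae_eq_integral => //.
  - exact: measurableT_comp.
  - by apply: measurableT_comp => //; exact/measurable_EFinP.
  - by apply: filterS pE => x /= -> _; rewrite mulKf// gt_eqF.
have nF := core_on_nonnegligible coreF F0.
exists th => //; apply/exp_lawP => // A mA.
have mkd : measurable_fun setT (fun x => k * exp_dens (closure F) th x).
  exact: measurable_funM.
have intd := (dom_integrable mu th (closure_measurable_rV F)).1 domF.
rewrite -(@normalizedZ _ _ _ _ k) ?gt_eqF//.
rewrite -(normalized_ae mp mkd pE mA) /normalized Pp//.
have := Pp measurableT; rewrite probability_setT => -[<-].
by rewrite divr1.
Qed.

Lemma unbounded_limit : ~ (exists M : R, \forall n \near U, `|eta n| <= M) ->
  exists tau G, [/\ exposes F tau G, recession_cone [set pi_ F x | x in ri Xi] tau,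
    {ae mu, forall x, ~ closure G x -> p x = 0} & tau != 0].
Proof.
move=> nb; pose l n := l2norm (eta n).
have loo M : \forall n \near U, M < l n.
  (* For an ultrafilter, not being eventually bounded by [M] means eventually exceeding [M]. *)
  have [UM|UM] := in_ultra_setVsetC [set n | `|eta n| <= M] UU.
    by exfalso; apply: nb; exists M.
  apply: filterS UM => n /negP; rewrite -ltNge => /lt_le_trans; apply.
  exact: norm_le_l2norm.
have cK := @compact_norm_le R d 1.
pose nu n := (l n)^-1 *: eta n.
have nu1 : \forall n \near U, l2norm (nu n) = 1.
  apply: filterS (loo 0) => n l0.
  by rewrite /nu l2normZ gtr0_norm ?invr_gt0// mulVf// gt_eqF.
have [|tau _ nutau] := @ultra_compact_cvg _ _ U nu _ UU cK.
  by apply: filterS nu1 => n /= <-; exact: norm_le_l2norm.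
have Ltau : lin F tau.
  have := closed_lin F0 => /closure_id ->.
  by apply: closure_cvg nutau => n; apply: linZ => //; exact: pi_lin.
have dotnu x : (fun n => (l n)^-1 * dot (eta n) x) @ U --> dot tau x.
  under eq_fun do rewrite -dotZl dotC; rewrite dotC.
  by apply: continuous_cvg nutau; exact: continuous_dot.
have tau1 : l2norm tau = 1.
  have h : (fun n => dot (nu n) (nu n)) @ U --> dot tau tau.
    rewrite /dot; apply: cvg_big => [|i _]; first exact: add_continuous.
    have hi : nu n ord0 i @[n --> U] --> tau ord0 i.
      have := @continuous_cvg _ _ _ U _ nu (fun M : E => M ord0 i) tau _ nutau.
      by apply; exact: (@coord_continuous R).
    exact: (cvgM hi hi).
  have h1 : (fun n => dot (nu n) (nu n)) @ U --> (1 : R).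
    apply: cvg_near_cst; apply: filterS nu1 => n; rewrite /l2norm => nu1.
    by rewrite -(sqr_sqrtr (dot_ge0 (nu n))) nu1 expr1n.
  by rewrite /l2norm -(cvg_lim (@Rhausdorff R) h) (cvg_lim (@Rhausdorff R) h1) sqrtr1.
have tau0 : tau != 0.
  apply/eqP => t0; move/eqP: tau1; rewrite t0 /l2norm dotE mul0mx mxE sqrtr0.
  by rewrite eq_sym oner_eq0.
(* Good points of positive density maximize <tau, .> among the good points of cl(F). *)
have sep a x : closure F a -> closure F x -> good a -> good x -> 0 < p a ->
    dot tau x <= dot tau a.
  move=> Fa Fx ga gx pa; rewrite -subr_le0 -dotBr.
  apply: (@density_ratio_le0 _ U UU (f ^~ a) (f ^~ x)
    (fun n => dot (eta n) (x - a)) l (p a) (p x)) => //.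
  by move=> n; exact: density_shift.
have [a [Fa ga pa]] := supported_gt0 suppF.
pose k := dot tau a; pose G := F `&` [set x | dot tau x = k].
(* The half-space is convex and carries the mass of cl(F), so it contains the core [F]. *)
have Fk x : F x -> dot tau x <= k.
  rewrite coreF => /(_ [set x | dot tau x <= k]); apply; split.
  - by apply: closed_measurable_rV; exact: closed_dot_le.
  - apply/convex_setP => y z t /= yk zk /andP[t0 t1]; rewrite dotDr !dotZr; nra.
  - apply: negligibleS ae_good => y [Fy yk] gy; apply: yk => /=.
    exact: sep.
have suppG : {ae mu, forall x, ~ closure G x -> p x = 0}.
  have nG : {ae mu, forall x, ~ ((closure F `&` [set x | dot tau x = k]) `\` closure G) x}.
    apply: negligibleS (negligible_supporting coreF Fk) => x /= /contrapT; exact.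
  apply: filterS3 suppF ae_good nG => x sx gx nx Gx.
  have [Fx|/sx//] := pselect (closure F x).
  apply/eqP; rewrite eq_le good_ge0// andbT leNgt; apply/negP => px.
  by apply: nx; split => //; split => //=; apply/eqP; rewrite eq_le !sep.
(* The reference point [a] is known only to lie in cl(F); since cl(G) carries [P], there is a point
   [b] of [F] itself on the hyperplane. *)
have [g [Gg _ _]] := supported_gt0 suppG.
have [b [[Fb /= bk] _]] := Gg setT filterT.
exists tau, G; split => //.
  rewrite (_ : G = F `&` [set x | dot tau (x - b) = 0]).
    apply: exposed_exposes => //; first by rewrite coreF; exact: convex_core_on.
    by move=> x Fx; rewrite dotBr bk subr_le0 Fk.
  rewrite /G; congr (_ `&` _); apply/seteqP; split => x /=; rewrite dotBr bk.
    by move=> ->; rewrite subrr.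
  by move/eqP; rewrite subr_eq0 => /eqP.
rewrite ri_pi//; apply: (@recession_ri _ _ U UU _ eta tau l) => //.
  have [Q QE] := pi_mx F0; rewrite (_ : pi_ F = fun x => x *m Q); last exact/funext.
  exact: convex_image.
by move=> n; exists (theta n).
Qed.

End face.

(** Induction on a strict bound [m] for the dimension of [lin F]: bounded projections finish on [F],
    unbounded ones extend the access sequence to a face of smaller dimension. *)
Lemma exp_family_face_limit m F (taus : seq E) (F_ : nat -> set E) :
  is_face (cc mu) F -> access_chain (cc mu) F taus F_ ->
  (forall i, (i < size taus)%N ->
    recession_cone [set pi_ (F_ i) x | x in ri Xi] taus`_i) ->
  (forall r (V : 'M[R]_(r, d)), lin F = [set u | (u <= V)%MS] -> (\rank V < m)%N) ->
  {ae mu, forall x, ~ closure F x -> p x = 0} ->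
  exists G, accessible_face Xi (cc mu) G /\ exp_family_face mu G Xi P.
Proof.
elim: m F taus F_ => [|m IH] F taus F_ faceF chain adapt rankF suppF.
  have [F0 _ _ _] := faceF; have [r [V [_ VE]]] := lin_rowspace F0.
  by have := rankF _ _ VE.
have [F0 cF _ _] := faceF; have [FC Fsize Fexp] := chain.
have coreF : F = core_on mu (closure F).
  by have := access_chain_core chain (leqnn _); rewrite Fsize.
have [[M etaM]|nb] := pselect (exists M : R, \forall n \near U, `|pi_ F (theta n)| <= M).
  exists F; split; last exact: bounded_limit etaM.
  by split => //; exists taus, F_.
have [tau [G [expG recG suppG tau0]]] := unbounded_limit F0 coreF suppF nb.
have [_ G0 LGF Ltau orth] := exposes_lin expG.
(* The old chain includes index [size taus], where it reaches [F]; [G] comes right after. *)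
pose G_ i := if (i <= size taus)%N then F_ i else G.
have G_F i : (i <= size taus)%N -> G_ i = F_ i by rewrite /G_ => ->.
have G_G : G_ (size taus).+1 = G by rewrite /G_ ltnn.
apply: (IH G (rcons taus tau) G_) => //.
- by apply: is_face_trans faceF _; case: expG => _ _ [].
- split; [by rewrite G_F|by rewrite size_rcons|].
  move=> i; rewrite size_rcons ltnS leq_eqVlt => /predU1P[->|ilt].
    by rewrite G_F// G_G Fsize nth_rcons ltnn eqxx.
  by rewrite !G_F//; [rewrite nth_rcons ilt; exact: Fexp|exact: ltnW].
- move=> i; rewrite size_rcons ltnS leq_eqVlt => /predU1P[->|ilt].
    by rewrite G_F// Fsize nth_rcons ltnn eqxx.
  by rewrite G_F; [rewrite nth_rcons ilt; exact: adapt|exact: ltnW].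
- move=> r V VE; have [r' [V' [_ VE']]] := lin_rowspace F0.
  rewrite -ltnS; apply: leq_trans (rankF _ _ VE').
  by rewrite ltnS; exact: lin_rank_lt VE' VE LGF Ltau tau0 orth.
Qed.

End descent.

Lemma cl_v_sub_exp_family_face (R : realType) (d : nat)
    (mu : {finite_measure set 'rV[R]_d -> \bar R}) (Xi : set 'rV[R]_d) :
  mu setT <> 0%E -> convex_set Xi ->
  (forall theta, Xi theta -> dom_log_laplace mu setT theta) ->
  cl_v (exp_family mu Xi) `<=`
  \bigcup_(F in [set F | accessible_face Xi (cc mu) F]) exp_family_face mu F Xi.
Proof.
move=> mu0 cXi domXi P clP.
have [theta [c [p [Xit c0 intp Pp ae_p]]]] := cl_v_density domXi mu0 clP.
(* [U] refines the filter at infinity, so sequential limits persist along it. *)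
have [U [UU ooU]] := ultraFilterLemma eventually_filter.
have ae_good : {ae mu, forall x, (fun n => c n * expR (dot (theta n) x)) @ U --> p x}.
  by apply: filterS ae_p => x px W Wx; apply: ooU; exact: px.
have supp : {ae mu, forall x, ~ closure (cc mu) x -> p x = 0}.
  have := negligible_core_on mu setT; rewrite -cc_core_on.
  by apply: negligibleS => x nx; split => // ccx; apply: nx => /(_ ccx).
have cc0 : cc mu !=set0.
  have [x [ccx _ _]] := supported_gt0 UU c0 intp Pp ae_good supp.
  by have [y [? _]] := ccx setT filterT; exists y.
have ccc : convex_set (cc mu) by rewrite cc_core_on; exact: convex_core_on.
suff [G [accG PG]] : exists G, accessible_face Xi (cc mu) G /\ exp_family_face mu G Xi P.
  by exists G.
(* The descent starts at the convex core with the empty access sequence; every rank is at most d. *)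
apply: (exp_family_face_limit UU cXi Xit c0 intp Pp ae_good (m := d.+1)
  (F := cc mu) (taus := [::]) (F_ := fun=> cc mu)) => //.
- exact: is_face_refl.
- by move=> r V _; rewrite ltnS rank_leq_col.
Qed.

Theorem theorem2 (R : realType) (d : nat)
    (mu : {finite_measure set 'rV[R]_d -> \bar R})
    (mu_neq0 : mu setT <> 0%E)
    (Xi : set 'rV[R]_d)
    (Xi_Theta : Xi `<=` Theta mu)
    (Xi_neq0 : Xi !=set0)
    (Xi_convex : convex_set Xi) :
  cl_v (exp_family mu Xi) =
  \bigcup_(F in [set F | accessible_face Xi (cc mu) F])
    exp_family_face mu F Xi.
Proof.
have domXi theta : Xi theta -> dom_log_laplace mu setT theta by move=> /Xi_Theta[].
apply/seteqP; split; first exact: cl_v_sub_exp_family_face.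
by move=> P [F accF PF]; exact: exp_family_face_sub_cl_v PF.
Qed.
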